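(* Let $n\geqslant1$, $\sigma\in\{1,2\}$, $p_1,p_2>1$, and consider the Cauchy problem $$\begin{cases}u_{tt}^N+\Delta^2u^N+\Delta\theta^N=f_1^N,&x\in\mathbb{R}^n,\ t>0,\\ \theta^N_t-\Delta\theta^N-\Delta u_t^N=f_2^N,&x\in\mathbb{R}^n,\ t>0,\\ (u^N,u_t^N,\theta^N)(0,x)=(u^N_0,u^N_1,\theta^N_0)(x),&x\in\mathbb{R}^n,\end{cases}$$ with $$f_j^N=c_{1,j}|u^N|^{p_j}+c_{2,j}\big|\,|\nabla|^{\sigma}u^N\big|^{p_j}+c_{3,j}|u_t^N|^{p_j}+c_{4,j}|\theta^N|^{p_j},\qquad j\in\{1,2\},$$ where $c_{d,j}\geqslant0$ for any $d\in\{1,\dots,4\}$ and $j\in\{1,2\}$, and $c_{1,1}+c_{1,2}>0$, $c_{4,1}+c_{4,2}>0$. Assume that for each $j\in\{1,2\}$: - $1<p_j\leqslant1+\frac{4}{(n-2)_+}$ if $c_{1,j}>0$, and - $1<p_j\leqslant1+\frac2n$ if $c_{4,j}>0$. Suppose that $u_0^N=0$ and $u_1^N+\theta_0^N\in L^1(\mathbb{R}^n)$ with $$\int_{\mathbb{R}^n}\big(u_1^N(x)+\theta_0^N(x)\big)\,\mathrm{d}x>0.$$ Then every local in time weak solution to this Cauchy problem blows up in finite time; that is, there is no global in time weak solution.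
   Context: $|\nabla|^{\sigma}g:=\mathcal{F}^{-1}(|\xi|^\sigma\widehat g\,)$, so $|\nabla|^2=-\Delta$. $(a)_+:=\max\{a,0\}$ and $1/(a)_+:=+\infty$ if $a\leqslant0$ (so for $n\leqslant2$ the first bound on $p_j$ just means $1<p_j<+\infty$). Definition (weak solution when $c_{1,1}+c_{1,2}>0$). A pair $(u^N,\theta^N)$ is a global in time weak solution of the Cauchy problem if, with $T=+\infty$, for each $j\in\{1,2\}$: $u^N\in L^{p_j}_{\mathrm{loc}}([0,T)\times\mathbb{R}^n)$ if $c_{1,j}>0$; $|\nabla|^{\sigma}u^N\in L^{p_j}_{\mathrm{loc}}([0,T)\times\mathbb{R}^n)$ if $c_{2,j}>0$; $u_t^N\in L^{p_j}_{\mathrm{loc}}([0,T)\times\mathbb{R}^n)$ if $c_{3,j}>0$; $\theta^N\in L^{p_j}_{\mathrm{loc}}([0,T)\times\mathbb{R}^n)$ if $c_{4,j}>0$; and the integral equalities $$\int_0^{+\infty}\!\!\int_{\mathbb{R}^n}f_1^N\Psi_1\,\mathrm{d}x\,\mathrm{d}t+\int_{\mathbb{R}^n}\big(-u_0^N(x)\,\partial_t\Psi_1(0,x)+u_1^N(x)\Psi_1(0,x)\big)\mathrm{d}x$$ $$=\int_0^{+\infty}\!\!\int_{\mathbb{R}^n}u^N\big(\partial_t^2\Psi_1+\Delta^2\Psi_1\big)\mathrm{d}x\,\mathrm{d}t+\int_0^{+\infty}\!\!\int_{\mathbb{R}^n}\theta^N\Delta\Psi_1\,\mathrm{d}x\,\mathrm{d}t$$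 and $$\int_0^{+\infty}\!\!\int_{\mathbb{R}^n}f_2^N\Psi_2\,\mathrm{d}x\,\mathrm{d}t+\int_{\mathbb{R}^n}\big(-u_0^N(x)\Delta\Psi_2(0,x)+\theta_0^N(x)\Psi_2(0,x)\big)\mathrm{d}x$$ $$=\int_0^{+\infty}\!\!\int_{\mathbb{R}^n}\theta^N\big(-\partial_t\Psi_2-\Delta\Psi_2\big)\mathrm{d}x\,\mathrm{d}t+\int_0^{+\infty}\!\!\int_{\mathbb{R}^n}u^N\Delta\partial_t\Psi_2\,\mathrm{d}x\,\mathrm{d}t$$ hold for all test functions $\Psi_1,\Psi_2\in\mathcal{C}_0^\infty([0,+\infty)\times\mathbb{R}^n)$. *)

(* Defs.v *)
From HB Require Import structures.
From mathcomp Require Import all_boot all_order all_algebra complex.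
From mathcomp Require Import all_classical all_reals all_analysis.

Set Implicit Arguments.
Unset Strict Implicit.
Unset Printing Implicit Defensive.

Import Order.TTheory GRing.Theory Num.Theory.
Import numFieldNormedType.Exports.

Local Open Scope classical_set_scope.
Local Open Scope ring_scope.

(** * Lebesgue measure on R^n *)

Definition rV_display : measure_display. Proof. exact: default_measure_display. Qed.

Section measurable_rV.
Context (R : realType) (n : nat).

Definition rV_coord (i : 'I_n) (x : 'rV[R]_n) : measurableTypeR R := x ord0 i.

Let rV_set0 : g_sigma_preimage rV_coord set0.
Proof. exact: sigma_algebra0. Qed.

Let rV_setC A : g_sigma_preimage rV_coord A -> g_sigma_preimage rV_coord (~` A).
Proof. exact: sigma_algebraC. Qed.

Let rV_bigcup (F : (set 'rV[R]_n)^nat) :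
  (forall i, g_sigma_preimage rV_coord (F i)) ->
  g_sigma_preimage rV_coord (\bigcup_i (F i)).
Proof. exact: sigma_algebra_bigcup. Qed.

(* The sigma-algebra generated by the coordinates, i.e., the Borel one. *)
HB.instance Definition _ := @isMeasurable.Build rV_display
  'rV[R]_n (g_sigma_preimage rV_coord) rV_set0 rV_setC rV_bigcup.


Lemma measurable_rV_coord (i : 'I_n) :
  measurable_fun [set: 'rV[R]_n] (rV_coord i).
Proof.
move=> _ Y mY; rewrite setTI; apply: sub_sigma_algebra => /=.
rewrite -bigcup_seq/=; exists i => /=; first by rewrite mem_index_enum.
by exists Y => //; rewrite setTI.
Qed.

Lemma measurable_fun_rV d (T : measurableType d) (f : T -> 'rV[R]_n) :
  (forall i, measurable_fun [set: T] (rV_coord i \o f)) ->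
  measurable_fun [set: T] f.
Proof.
move=> mf.
suff : g_sigma_preimage (fun i => rV_coord i \o f) `<=` measurable.
  rewrite g_sigma_preimage_comp => prefS _ A mA.
  by apply: prefS; exists A.
apply: smallest_sub; first exact: sigma_algebra_measurable.
by rewrite -bigcup_seq => A [i _ [B mB <-]]; exact: mf.
Qed.

End measurable_rV.

Section cons_rV.
Context (R : realType) (n : nat).

Definition cons_rV (z : measurableTypeR R * 'rV[R]_n) : 'rV[R]_n.+1 :=
  row_mx (const_mx z.1 : 'rV_1) z.2 : 'rV_(1 + n).

Definition uncons_rV (x : 'rV[R]_n.+1) : measurableTypeR R * 'rV[R]_n :=
  (x ord0 ord0, \row_j x ord0 (lift ord0 j)).

Lemma cons_rVK : cancel cons_rV uncons_rV.
Proof.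
move=> [a x]; rewrite /uncons_rV /cons_rV; congr pair.
  by rewrite mxE; case: splitP => // j _; rewrite mxE.
apply/rowP => j; rewrite mxE [LHS]mxE; case: splitP => [k|k].
  by rewrite (ord1 k).
by rewrite /= /bump/= => -[] jk; congr (x _ _); exact/val_inj.
Qed.

Lemma measurable_cons_rV : measurable_fun setT cons_rV.
Proof.
apply: measurable_fun_rV => i; rewrite /rV_coord /cons_rV /comp.
under eq_fun do rewrite mxE.
case: splitP => j _; first by under eq_fun do rewrite mxE; exact: measurable_fst.
exact: (measurableT_comp (@measurable_rV_coord R n j) measurable_snd).
Qed.

Lemma measurable_uncons_rV : measurable_fun setT uncons_rV.
Proof.
apply/measurable_fun_pairP; split; first exact: (@measurable_rV_coord R n.+1).
apply: measurable_fun_rV => i; rewrite /rV_coord /comp /=.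
under eq_fun do rewrite mxE.
exact: (@measurable_rV_coord R n.+1).
Qed.

End cons_rV.

Section lebesgue_rV_step.
Context (R : realType) (n : nat).
Variable mu : {sigma_finite_measure set 'rV[R]_n -> \bar R}.

Definition lebesgue_rV_step : set 'rV[R]_n.+1 -> \bar R :=
  pushforward (lebesgue_measure \x mu)%E (@cons_rV R n).

Let pushforward_step : {measure set 'rV[R]_n.+1 -> \bar R} :=
  measure_function_pushforward__canonical__measure_function_Measure
    (lebesgue_measure \x mu)%E (@measurable_cons_rV R n).

HB.instance Definition _ := Measure.copy lebesgue_rV_step pushforward_step.

Let step_sigma_finite : sigma_finite setT lebesgue_rV_step.
Proof.
have /sigma_finiteP[F [TF ndF Foo]] :=
  sigma_finiteT (@lebesgue_measure R : {sigma_finite_measure set _ -> \bar R}).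
have /sigma_finiteP[G [TG ndG Goo]] := sigma_finiteT mu.
exists (fun k => @uncons_rV R n @^-1` (F k `*` G k)).
  rewrite -preimage_bigcup (_ : \bigcup_k _ = setT) ?preimage_setT//.
  rewrite -setXTT TF TG predeqE => -[x y]; split.
    by move=> [k _ []/= ? ?]; split; exists k.
  move=> [/= [k _ Fkx] [l _ Gly]]; exists (maxn k l) => //; split.
  - by move: x Fkx; exact/subsetPset/ndF/leq_maxl.
  - by move: y Gly; exact/subsetPset/ndG/leq_maxr.
move=> k; have [? ?] := Foo k; have [? ?] := Goo k; split.
  rewrite -[X in measurable X]setTI.
  by apply: measurable_uncons_rV => //; exact: measurableX.
rewrite /lebesgue_rV_step /pushforward -comp_preimage.
rewrite (_ : _ \o _ = id); last by apply/funext => z; exact: cons_rVK.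
by rewrite product_measure1E// lte_mul_pinfty// ge0_fin_numE.
Qed.

HB.instance Definition _ := Measure_isSigmaFinite.Build _ _ _ lebesgue_rV_step
  step_sigma_finite.

End lebesgue_rV_step.

Fixpoint lebesgue_rV (R : realType) (n : nat) :
    {sigma_finite_measure set 'rV[R]_n -> \bar R} :=
  match n with
  | 0 => (\d_(0 : 'rV[R]_0))%R
  | n'.+1 => lebesgue_rV_step (lebesgue_rV R n')
  end.

Lemma lebesgue_rV_box (R : realType) (n : nat)
    (A : 'I_n -> set (measurableTypeR R)) : (forall i, measurable (A i)) ->
  lebesgue_rV R n [set x | forall i, A i (x ord0 i)] =
  (\prod_(i < n) lebesgue_measure (A i))%E.
Proof.
elim: n A => [|n IHn] A mA; rewrite /=.
  by rewrite big_ord0 diracE mem_set//= => -[].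
rewrite /lebesgue_rV_step /pushforward big_ord_recl -IHn//.
have mB : measurable [set x : 'rV[R]_n | forall i, A (lift ord0 i) (x ord0 i)].
  rewrite (_ : [set _ | _] =
      \bigcap_(i in [set: 'I_n]) (rV_coord i @^-1` A (lift ord0 i))).
    apply: fin_bigcap_measurable => // i _.
    rewrite -[X in measurable X]setTI.
    exact: measurable_rV_coord.
  by apply/seteqP; split => x /= h i; [move=> _; exact: h|exact: (h i)].
rewrite -product_measure1E//.
congr product_measure1; apply/seteqP; split => -[a x] /=;
  have /(congr1 fst)/= Ea := cons_rVK (a, x);
  have /(congr1 snd)/= Ex := cons_rVK (a, x).
- move=> h; split => [|i]; first by rewrite -Ea; exact: h.
  by rewrite -Ex mxE; exact: h.
- move=> [h0 h] i; case: (unliftP ord0 i) => [j|] ->; last by rewrite Ea.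
  by have := h j; rewrite -[in X in X -> _]Ex mxE.
Qed.

(** * Test functions *)

Section smooth.
Context (R : realType) (V : normedModType R).

Definition iter_derive (vs : seq V) (f : V -> R) : V -> R :=
  foldr (fun v g => 'D_v g) f vs.

Definition smooth (f : V -> R) := forall vs : seq V,
  continuous (iter_derive vs f) /\
  forall x v, derivable (iter_derive vs f) x v.

Definition closed_support (f : V -> R) : set V := closure [set x | f x != 0].

End smooth.

Section weak_solutions.
Context (R : realType) (n : nat).

Local Notation X := 'rV[R]_n.
(* A point of space-time is z = (t, x). *)
Local Notation TX := (measurableTypeR R * 'rV[R]_n)%type.

(* `|x| on 'rV[R]_n is the sup norm; |xi| below has to be the Euclidean norm. *)
Definition dotv (x y : X) : R := \sum_i x ord0 i * y ord0 i.
Definition enorm (x : X) : R := Num.sqrt (dotv x x).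

Local Notation dx := (lebesgue_rV R n).
Local Notation dtdx := (lebesgue_measure \x lebesgue_rV R n)%E.

Definition future : set TX := [set z | 0 <= z.1].

(* C_0^oo([0, +oo) x R^n) is the set of the restrictions to t >= 0 of the
   compactly supported smooth functions on R x R^n. *)
Definition test_fun (phi : R * X -> R) := smooth phi /\ compact (closed_support phi).

(* C_0^oo((0, +oo) x R^n) *)
Definition interior_test_fun (phi : R * X -> R) :=
  test_fun phi /\ closed_support phi `<=` [set z | 0 < z.1].

Definition dt (f : R * X -> R) : R * X -> R := 'D_(1, 0) f.
Definition dxi (i : 'I_n) (f : R * X -> R) : R * X -> R :=
  'D_(0, delta_mx ord0 i) f.
Definition laplacian (f : R * X -> R) (z : R * X) : R :=
  \sum_i dxi i (dxi i f) z.

(** * The operator |nabla|^sigma *)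

Local Open Scope complex_scope.

Definition cint (f : X -> R[i]) : R[i] :=
  (\int[dx]_x complex.Re (f x)) +i* (\int[dx]_x complex.Im (f x)).

Definition cis (a : R) : R[i] := cos a +i* sin a.

Definition fourier (f : X -> R[i]) (xi : X) : R[i] :=
  cint (fun x => cis (- dotv x xi) * f x).

Definition inv_fourier (f : X -> R[i]) (x : X) : R[i] :=
  ((pi *+ 2) ^- n)%:C * cint (fun xi => cis (dotv x xi) * f xi).

Definition absnabla (sigma : nat) (f : X -> R[i]) : X -> R[i] :=
  inv_fourier (fun xi => (enorm xi ^+ sigma)%:C * fourier f xi).

(* |nabla|^sigma in the space variable; it maps real functions to real
   functions, since the symbol is real and even. *)
Definition absnabla_x (sigma : nat) (f : R * X -> R) (z : R * X) : R :=
  complex.Re (absnabla sigma (fun y => (f (z.1, y))%:C) z.2).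

Local Close Scope complex_scope.

(* v = F^-1(|xi|^sigma F u) in the sense of distributions on (0, +oo) x R^n:
   as the symbol is even, the operator is moved unchanged to the test
   function. For sigma = 1 it is nonlocal, whence the integrability
   condition. *)
Definition is_absnabla (sigma : nat) (u v : R * X -> R) :=
  forall phi, interior_test_fun phi ->
    dtdx.-integrable future (EFin \o (u \* absnabla_x sigma phi)) /\
    \int[dtdx]_(z in future) (v z * phi z) =
    \int[dtdx]_(z in future) (u z * absnabla_x sigma phi z).

(* w = u_t in the sense of distributions on (0, +oo) x R^n *)
Definition is_weak_dt (u w : R * X -> R) :=
  forall phi, interior_test_fun phi ->
    \int[dtdx]_(z in future) (w z * phi z) =
    - \int[dtdx]_(z in future) (u z * dt phi z).

(** * Weak solutions *)

(* L^p_loc([0, +oo) x R^n) *)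
Definition Lploc (p : R) (f : R * X -> R) :=
  measurable_fun future f /\
  forall K : set TX, K `<=` future -> compact (K : set (R * X)) ->
    (\int[dtdx]_(z in K) (`|f z| `^ p)%:E < +oo)%E.

(* L^1_loc(R^n) *)
Definition L1loc (f : X -> R) :=
  forall K, compact K -> dx.-integrable K (EFin \o f).

(* v and w stand for |nabla|^sigma u and u_t. *)
Definition source (p c1 c2 c3 c4 : R) (u v w theta : R * X -> R) (z : R * X)
    : R :=
  c1 * `|u z| `^ p + c2 * `|v z| `^ p + c3 * `|w z| `^ p +
  c4 * `|theta z| `^ p.

(* The indices j = 1, 2 of the equations are the elements 0, 1 of 'I_2. The
   distributions |nabla|^sigma u and u_t are required to be functions, v and w,
   only where they occur. L1loc on the data gives a meaning to the integrals at
   t = 0. *)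
Definition global_weak_solution (sigma : nat) (p c1 c2 c3 c4 : 'I_2 -> R)
    (u0 u1 theta0 : X -> R) (u theta : R * X -> R) :=
  exists v w : R * X -> R,
  let f j := source (p j) (c1 j) (c2 j) (c3 j) (c4 j) u v w theta in
  [/\ [/\ L1loc u0, L1loc u1 & L1loc theta0],
      forall j, [/\ 0 < c1 j -> Lploc (p j) u,
        0 < c2 j -> is_absnabla sigma u v /\ Lploc (p j) v,
        0 < c3 j -> is_weak_dt u w /\ Lploc (p j) w &
        0 < c4 j -> Lploc (p j) theta],
      forall Psi, test_fun Psi ->
        \int[dtdx]_(z in future) (f 0 z * Psi z) +
        \int[dx]_x (- u0 x * dt Psi (0, x) + u1 x * Psi (0, x)) =
        \int[dtdx]_(z in future)
          (u z * (dt (dt Psi) z + laplacian (laplacian Psi) z)) +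
        \int[dtdx]_(z in future) (theta z * laplacian Psi z) &
      forall Psi, test_fun Psi ->
        \int[dtdx]_(z in future) (f 1 z * Psi z) +
        \int[dx]_x (- u0 x * laplacian Psi (0, x) + theta0 x * Psi (0, x)) =
        \int[dtdx]_(z in future) (theta z * (- dt Psi z - laplacian Psi z)) +
        \int[dtdx]_(z in future) (u z * laplacian (dt Psi) z)].

End weak_solutions.

(* 1 / (a)_+ *)
Definition inv_pospart (R : realType) (a : R) : \bar R :=
  if a <= 0 then +oo%E else (a^-1)%:E.

(* Main.v *)
Require Import Defs.
From mathcomp Require Import all_boot all_order all_algebra.
From mathcomp Require Import all_classical all_reals all_analysis.
From mathcomp Require Import measurable_realfun ring lra.

Import Order.TTheory GRing.Theory Num.Theory.
Import numFieldNormedType.Exports.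

Local Open Scope classical_set_scope.
Local Open Scope ring_scope.

(** The argument rescales a single test function. Put the same [Psi] in both
    equations and add them: the terms [theta * laplacian Psi] cancel, and since
    [u0] vanishes
    [[
      \int\int (f_1 + f_2) Psi + \int (u1 + theta0) Psi(0, .) =
        \int\int u (dt^2 + laplacian^2 + laplacian dt) Psi
        - \int\int theta (dt Psi)
    ]]
    (lemma [summed_equation]). Now take [Psi_r (t, x) = Psi (t / r^2, x / r)].
    The weight carried by [u] is [r^-4 * A (t / r^2, x / r)] and the one carried
    by [theta] is [r^-2 * B (t / r^2, x / r)], on a support of measure of order
    [r^(n + 2)]; the exponents allowed for [p_j] are exactly those for which
    these powers of [r] are enough.

    Write [F = f_1 + f_2]; it dominates a multiple of [|w|^p] for [w = u] and
    for [w = theta], each with its own exponent. If [|G| <= C Psi^(1/p)], then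
    splitting according to whether [|w G|] exceeds a threshold proportional to
    [r^(m - n - 2)] gives, pointwise,
    [[
      r^-m |w| |G_r| <= C lam^(1 - p) |w|^p Psi_r + lam r^-(n + 2) 1_cylinder
    ]]
    with [C] independent of [r >= 1] as soon as [(n + 2 - m) (p - 1) <= m]
    (lemmas [scaled_le_powR_add] and [excess_le]). This is used twice.
    - With [lam] large, the right-hand side of the summed equation is absorbed
      by [\int\int F Psi_r] up to a constant (lemma [absorption]); hence
      [\int\int F Psi_r] is bounded in [r], and [F] is integrable by Fatou's
      lemma (lemma [integrable_weight_limit]).
    - Once [F] is integrable, the part of [r^-m |w| |G_r|] above the threshold
      is dominated by a multiple of [F] and tends to 0 pointwise, so its
      integral tends to 0, while the part below contributes at most a multiple
      of the arbitrarily small [lam] (lemma [vanishing]). This settles the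
      critical exponents together with the subcritical ones.
    So the right-hand side tends to 0, whereas the left-hand side is at least
    [\int (u1 + theta0) Psi_r(0, .)], which tends to the positive number
    [Psi(0, 0) \int (u1 + theta0)].

    The test function has to satisfy [|D Psi| <= C Psi^(1/p)] for every
    derivative that occurs, at its boundary as well. This holds for
    [Psi = exp (-1 / q)] with [q = 1 - t^2 - |x|^2]: its derivatives are
    combinations of functions [P (1 / q) exp (-1 / q)] with [P] a polynomial,
    and exponential decay beats any polynomial. *)

(** * Flat functions of one variable *)

Lemma horner_le_expR {R : realType} (P : {poly R}) (e : R) : 0 < e ->
  exists2 C, 0 <= C & forall y, 0 <= y -> `|P.[y]| <= C * expR (e * y).
Proof.
elim/poly_ind: P e => [|P c IH] e e0.
  by exists 0 => // y y0; rewrite horner0 normr0 mul0r.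
have e20 : 0 < e / 2 by rewrite divr_gt0.
have [C C0 HC] := IH _ e20.
exists (C * (e / 2)^-1 + `|c|).
  by rewrite addr_ge0// mulr_ge0// invr_ge0 ltW.
move=> y y0; rewrite hornerMXaddC mulrDl (le_trans (ler_normD _ _))// lerD//.
  rewrite normrM (ger0_norm y0).
  have -> : e * y = e / 2 * y + e / 2 * y by lra.
  have hy : y <= (e / 2)^-1 * expR (e / 2 * y).
    rewrite ler_pdivlMl//; have := expR_ge1Dx (e / 2 * y); lra.
  by rewrite expRD mulrACA ler_pM// HC.
by rewrite ler_peMr// -expR0 ler_expR mulr_ge0// ltW.
Qed.

(** The functions [P (1 / s) exp (-1 / s)] for all polynomials [P] at once:
    unlike [exp (-1 / s)] alone, this family is stable under differentiation. *)
Definition flat {R : realType} (P : {poly R}) (s : R) : R :=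
  if 0 < s then P.[s^-1] * expR (- s^-1) else 0.

(** With [y = 1 / s], the claim is that [|P y| <= C exp ((1 - k) y)], the factor
    [exp (- y)] being split into the powers [1 - k] and [k]. *)
Lemma flat_le_powR {R : realType} (P : {poly R}) (k : R) : k < 1 ->
  exists2 C, 0 <= C & forall s, `|flat P s| <= C * flat 1 s `^ k.
Proof.
move=> k1; have [|C C0 HC] := @horner_le_expR R P (1 - k); first by lra.
exists C => // s; rewrite /flat; case: ifPn => [s0|_]; last first.
  by rewrite normr0 mulr_ge0// powR_ge0.
rewrite hornerC mul1r -expRM normrM (ger0_norm (expR_ge0 _)).
have -> : - s^-1 * k = (1 - k) * s^-1 + - s^-1 by lra.
by rewrite expRD mulrA ler_wpM2r ?expR_ge0// HC// invr_ge0 ltW.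
Qed.

Lemma flat_ge0 {R : realType} (s : R) : 0 <= flat 1 s.
Proof. by rewrite /flat; case: ifP => // _; rewrite hornerC mul1r expR_ge0. Qed.

Lemma flat_le1 {R : realType} (s : R) : flat 1 s <= 1.
Proof.
rewrite /flat; case: ifPn => // s0; rewrite hornerC mul1r -expR0 ler_expR.
by rewrite oppr_le0 invr_ge0 ltW.
Qed.

(** Makes the difference quotients at 0 small: the quotient of [flat P] is
    [flat ('X * P)]. *)
Lemma flat_le_norm {R : realType} (P : {poly R}) :
  exists2 C, 0 <= C & forall s, `|flat P s| <= C * `|s|.
Proof.
have [C C0 HC] := @horner_le_expR R ('X * P) 1 ltr01.
exists C => // s; rewrite /flat; case: ifPn => [s0|_]; last first.
  by rewrite normr0 mulr_ge0.
have si0 : 0 <= s^-1 by rewrite invr_ge0 ltW.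
have := HC _ si0; rewrite hornerM hornerX normrM (ger0_norm si0) mul1r => h.
rewrite normrM (gtr0_norm s0) (ger0_norm (expR_ge0 _)) expRN.
by rewrite ler_pdivrMr ?expR_gt0// mulrAC (mulrC _ s) -ler_pdivrMl.
Qed.

(** For [s > 0] and [y = 1 / s], the derivative of [y] is [- y^2], whence the
    factor ['X^2]. *)
Lemma is_derive_flat {R : realType} (P : {poly R}) (s : R) :
  is_derive s 1 (flat P) (flat ('X^2 * (P - P^`())) s).
Proof.
have [s0|s0|->] := ltrgt0P s.
- have -> : flat ('X^2 * (P - P^`())) s =
    P^`().[s^-1] * - (s ^- 2) * expR (- s^-1)
      + P.[s^-1] * (expR (- s^-1) * (- - (s ^- 2))).
    by rewrite /flat s0 !hornerE /= exprVn; ring.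
  apply: (@near_eq_is_derive R R R
    (fun s : R => P.[s^-1] * expR (- s^-1)) (flat P)).
    near=> t; rewrite /flat ifT//; near: t.
    exact: lt_nbhsr.
  have dV : is_derive s 1 (fun y : R => y^-1) (- s ^- 2).
    apply: DeriveDef; first by apply: derivableV => //; rewrite gt_eqF.
    by rewrite deriveV ?gt_eqF// derive_id [LHS]mulr1.
  have dP := @is_derive1_comp R (horner P) (fun y => y^-1) s _ _
    (is_derive_poly P s^-1) dV.
  have dE := @is_derive1_comp R expR (fun y => - y^-1) s _ _
    (is_derive_expR (- s^-1)) (is_deriveN dV).
  apply: (is_derive_eq (is_deriveM dP dE)).
  by rewrite /GRing.scale/=; ring.
- have -> : flat ('X^2 * (P - P^`())) s = 0.
    by rewrite /flat ltNge ltW.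
  apply: (@near_eq_is_derive R R R (cst 0) (flat P)).
  near=> t; rewrite /flat ifF//; apply/negbTE; rewrite -leNgt ltW//; near: t.
  exact: lt_nbhsl.
- have -> : flat ('X^2 * (P - P^`())) (0:R) = 0 by rewrite /flat ltxx.
  suff h : h^-1 *: ((flat P \o shift 0) (h *: (1 : R)) - flat P 0)
      @[h --> 0^'] --> (0 : R).
    by apply: DeriveDef; [apply/cvg_ex; exists 0|exact/cvg_lim].
  have [C C0 HC] := flat_le_norm ('X * P).
  apply: norm_cvg0; apply: (@squeeze_cvgr _ _ _ _ (cst 0) (fun h => C * `|h|)).
  + near=> h; rewrite normr_ge0/=.
    rewrite addr0 [h *: _]mulr1 {2}/flat ltxx subr0.
    apply: le_trans (HC h); rewrite le_eqVlt; apply/orP; left; apply/eqP.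
    congr (`| _ |); rewrite /flat; case: ifP => _; last by rewrite scaler0.
    by rewrite hornerM hornerX [LHS]mulrA.
  + exact: cvg_cst.
  + rewrite -[X in _ --> X](mulr0 C); apply: cvgM; first exact: cvg_cst.
    apply: cvg_trans; first apply: cvg_app; first exact: nbhs_dnbhs.
    by rewrite -{2}(@normr0 _ R); exact: norm_continuous.
Unshelve. all: by end_near. Qed.

Lemma continuous_flat {R : realType} (P : {poly R}) : continuous (flat P).
Proof.
move=> s; apply: differentiable_continuous; apply/derivable1_diffP.
by case: (is_derive_flat P s).
Qed.

(** * An algebra of bump functions stable under differentiation *)

Section bump_algebra.
Context {R : realType} {n : nat}.
Local Notation V := (R * 'rV[R]_n)%type.
Local Notation TX := (measurableTypeR R * 'rV[R]_n)%type.
Implicit Types (z v w : V) (f g : V -> R).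

Definition stdot z v : R := z.1 * v.1 + dotv z.2 v.2.

Definition ballfun z : R := 1 - stdot z z.

(** Linear forms [stdot ^~ v] are what differentiating [ballfun] produces, so
    that these four clauses are closed under directional derivatives. The
    properties of the test function and of its derivatives are all proved by
    induction on this predicate. *)
Inductive bump_fun : (V -> R) -> Prop :=
| bump_flat P : bump_fun (fun z => flat P (ballfun z))
| bump_dot v f : bump_fun f -> bump_fun (fun z => stdot z v * f z)
| bump_scale c f : bump_fun f -> bump_fun (fun z => c * f z)
| bump_add f g : bump_fun f -> bump_fun g -> bump_fun (fun z => f z + g z).

Lemma stdotC z v : stdot z v = stdot v z.
Proof.
by rewrite /stdot mulrC; congr (_ + _); apply: eq_bigr => i _; rewrite mulrC.
Qed.

Lemma stdotDl z w v : stdot (z + w) v = stdot z v + stdot w v.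
Proof.
rewrite /stdot /= mulrDl addrACA; congr (_ + _).
by rewrite /dotv -big_split/=; apply: eq_bigr => i _; rewrite mxE mulrDl.
Qed.

Lemma stdotZl (h : R) z v : stdot (h *: z) v = h * stdot z v.
Proof.
rewrite /stdot /= mulrDr mulrA; congr (_ + _).
by rewrite /dotv mulr_sumr; apply: eq_bigr => i _; rewrite mxE mulrA.
Qed.

Lemma stdotDr z v w : stdot z (v + w) = stdot z v + stdot z w.
Proof. by rewrite stdotC stdotDl !(stdotC z). Qed.

Lemma stdotZr (h : R) z v : stdot z (h *: v) = h * stdot z v.
Proof. by rewrite stdotC stdotZl stdotC. Qed.

Lemma differentiable_row_coord (i : 'I_n) z :
  differentiable (fun z : V => z.2 ord0 i) z.
Proof.
apply: (@differentiable_comp _ V 'rV[R]_n R snd (fun x => x ord0 i)).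
  by apply: linear_differentiable => x; exact: cvg_snd.
exact: differentiable_coord.
Qed.

Lemma differentiable_fst z : differentiable (fst : V -> R) z.
Proof. by apply: linear_differentiable => x; exact: cvg_fst. Qed.

Lemma differentiable_stdot (f : V -> V) z :
  (forall z, differentiable (fst \o f) z) ->
  (forall i z, differentiable (fun z => (f z).2 ord0 i) z) ->
  differentiable (fun z => stdot z (f z)) z.
Proof.
move=> f1 f2; apply: differentiableD.
  by apply: differentiableM; [exact: differentiable_fst|exact: f1].
rewrite [X in differentiable X _](_ : _ =
    \sum_(i < n) (fun z => z.2 ord0 i * (f z).2 ord0 i)); last first.
  by apply/funext => y; rewrite fct_sumE.
apply: differentiable_sum => i.
  apply: differentiableM; last exact: f2.
exact: differentiable_row_coord.
Qed.

Lemma differentiable_stdotl v z : differentiable (stdot^~ v) z.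
Proof.
by apply: (@differentiable_stdot (cst v)) => *; exact: differentiable_cst.
Qed.

Lemma differentiable_ballfun z : differentiable ballfun z.
Proof.
apply: differentiableB; first exact: differentiable_cst.
apply: (@differentiable_stdot id) => *; first exact: differentiable_fst.
exact: differentiable_row_coord.
Qed.

Lemma is_derive_stdotl v z w : is_derive z w (stdot^~ v) (stdot w v).
Proof.
apply: DeriveDef; first exact/diff_derivable/differentiable_stdotl.
apply: cvg_lim => //; apply: cvg_near_cst; near=> h.
rewrite /= stdotDl stdotZl addrK /GRing.scale/= mulKf//.
by near: h; exact: nbhs_dnbhs_neq.
Unshelve. all: by end_near. Qed.

Lemma is_derive_ballfun z w : is_derive z w ballfun (-2 * stdot z w).
Proof.
apply: DeriveDef; first exact/diff_derivable/differentiable_ballfun.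
apply: cvg_lim => //.
have L : -2 * stdot z w - h * stdot w w @[h --> (0 : R)^'] --> -2 * stdot z w.
  rewrite -[X in _ --> X]subr0; apply: cvgB; first exact: cvg_cst.
  rewrite -[X in _ --> X](mul0r (stdot w w)); apply: cvgMr_tmp.
  exact: nbhs_dnbhs.
apply: cvg_trans L; apply: near_eq_cvg; near=> h.
have h0 : h != 0 by near: h; exact: nbhs_dnbhs_neq.
rewrite /= /ballfun !(stdotDl, stdotDr, stdotZl, stdotZr) (stdotC w z).
by rewrite /GRing.scale/=; field.
Unshelve. all: by end_near. Qed.

Lemma is_derive_flat_ballfun P z w :
  is_derive z w (fun z => flat P (ballfun z))
    (flat ('X^2 * (P - P^`())) (ballfun z) * (-2 * stdot z w)).
Proof.
have db := differentiable_ballfun z.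
have df : differentiable (flat P) (ballfun z).
  by apply/derivable1_diffP; case: (is_derive_flat P (ballfun z)).
apply: DeriveDef; first exact/diff_derivable/differentiable_comp.
rewrite deriveE; last exact: differentiable_comp.
rewrite (diff_comp db df) /= -(deriveE w db) diff1E// derive1E.
rewrite (@derive_val _ _ _ _ _ _ _ (is_derive_flat P (ballfun z))).
rewrite (@derive_val _ _ _ _ _ _ _ (is_derive_ballfun z w)).
by rewrite /GRing.scale/= mulrC.
Qed.

Lemma bump_differentiable f z : bump_fun f -> differentiable f z.
Proof.
move=> bf; elim: bf z => {f} [P|v f _ IH|c f _ IH|f g _ IHf _ IHg] z.
- apply: (@differentiable_comp _ V R R ballfun (flat P)).
    exact: differentiable_ballfun.
  by apply/derivable1_diffP; case: (is_derive_flat P (ballfun z)).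
- by apply: differentiableM; [exact: differentiable_stdotl|exact: IH].
- by apply: differentiableM; [exact: differentiable_cst|exact: IH].
- exact: differentiableD.
Qed.

Lemma bump_is_derive f z w : bump_fun f -> is_derive z w f ('D_w f z).
Proof. by move=> bf; exact/derivableP/diff_derivable/bump_differentiable. Qed.

Lemma bump_derive f w : bump_fun f -> bump_fun ('D_w f).
Proof.
elim=> {f} [P|v f bf IH|c f bf IH|f g bf IHf bg IHg].
- rewrite (_ : 'D_w _ = fun z => -2 * (stdot z w *
    flat ('X^2 * (P - P^`())) (ballfun z))).
    by apply: bump_scale; apply: bump_dot; exact: bump_flat.
  apply/funext => z.
  rewrite (@derive_val _ _ _ _ _ _ _ (is_derive_flat_ballfun P z w)); ring.
- rewrite (_ : 'D_w _ = fun z => stdot z v * 'D_w f z + stdot w v * f z).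
    by apply: bump_add; [exact: bump_dot|exact: bump_scale].
  apply/funext => z; have fz := @bump_is_derive f z w bf.
  rewrite (@derive_val _ _ _ _ _ _ _
    (is_deriveM (is_derive_stdotl v z w) fz)).
  by rewrite /GRing.scale/= [f z * _]mulrC.
- rewrite (_ : 'D_w _ = fun z => c * 'D_w f z); first exact: bump_scale.
  apply/funext => z; have fz := @bump_is_derive f z w bf.
  by rewrite (@derive_val _ _ _ _ _ _ _ (is_deriveZ c fz)).
- rewrite (_ : 'D_w _ = fun z => 'D_w f z + 'D_w g z); first exact: bump_add.
  apply/funext => z; have fz := @bump_is_derive f z w bf.
  have gz := @bump_is_derive g z w bg.
  by rewrite (@derive_val _ _ _ _ _ _ _ (is_deriveD fz gz)).
Qed.

Lemma bump_sum (I : Type) (s : seq I) (F : I -> V -> R) :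
  (forall i, bump_fun (F i)) -> bump_fun (fun z => \sum_(i <- s) F i z).
Proof.
move=> bF; elim: s => [|i s IH].
  rewrite (_ : (fun _ => _) = fun z => 0 * flat 1 (ballfun z)).
    by apply: bump_scale; exact: bump_flat.
  by apply/funext => z; rewrite big_nil mul0r.
rewrite (_ : (fun _ => _) = fun z => F i z + \sum_(j <- s) F j z).
  exact: bump_add.
by apply/funext => z; rewrite big_cons.
Qed.

Lemma bump_dt f : bump_fun f -> bump_fun (dt f).
Proof. exact: bump_derive. Qed.

Lemma bump_laplacian f : bump_fun f -> bump_fun (laplacian f).
Proof. by move=> bf; apply: bump_sum => i; do 2 apply: bump_derive. Qed.

Lemma bump_eq0 f z : bump_fun f -> ballfun z <= 0 -> f z = 0.
Proof.
move=> bf z0; elim: bf => {f} [P|v f _ IH|c f _ IH|f g _ IHf _ IHg].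
- by rewrite /flat ltNge z0.
- by rewrite IH mulr0.
- by rewrite IH mulr0.
- by rewrite IHf IHg addr0.
Qed.

Lemma ballfun_le1 z : 0 < ballfun z ->
  `|z.1| <= 1 /\ forall i, `|z.2 ord0 i| <= 1.
Proof.
rewrite /ballfun /stdot -!expr2 => z1.
have d0 : 0 <= dotv z.2 z.2 by apply: sumr_ge0 => i _; exact: sqr_ge0.
have h (y : R) : y ^+ 2 <= 1 -> `|y| <= 1.
  by rewrite -sqrtr_sqr -{2}sqrtr1 => y1; rewrite ler_wsqrtr.
split=> [|i]; apply: h; first by nra.
suff : z.2 ord0 i ^+ 2 <= dotv z.2 z.2 by have := sqr_ge0 z.1; lra.
rewrite /dotv (bigD1 i)//= -expr2 lerDl.
by apply: sumr_ge0 => j _; exact: sqr_ge0.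
Qed.

(** All powers [k < 1] of the basic profile are allowed; [k = 1 / p] is what the
    threshold estimate needs. The linear factors are harmless because they are
    bounded on the unit ball, outside of which every bump function vanishes. *)
Lemma bump_le_powR f (k : R) : k < 1 -> bump_fun f ->
  exists2 C, 0 <= C & forall z, `|f z| <= C * flat 1 (ballfun z) `^ k.
Proof.
move=> k1; elim=> {f} [P|v f bf [C C0 IH]|c f bf [C C0 IH]|
                       f g bf [C C0 IHf] bg [D D0 IHg]].
- by have [C C0 HC] := flat_le_powR P _ k1; exists C.
- exists ((`|v.1| + \sum_i `|v.2 ord0 i|) * C).
    by rewrite mulr_ge0// addr_ge0// sumr_ge0.
  move=> z; have [z0|z0] := leP (ballfun z) 0.
    rewrite (bump_eq0 _ _ bf z0) mulr0 normr0 !mulr_ge0 ?powR_ge0//.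
    by rewrite addr_ge0// sumr_ge0.
  have [z1 z2] := ballfun_le1 _ z0.
  rewrite normrM -mulrA ler_pM// (le_trans (ler_normD _ _))// lerD//.
    by rewrite normrM ler_piMl.
  rewrite (le_trans (ler_norm_sum _ _ _))// ler_sum// => i _.
  by rewrite normrM ler_piMl.
- exists (`|c| * C) => [|z]; first by rewrite mulr_ge0.
  by rewrite normrM -mulrA ler_wpM2l.
- exists (C + D) => [|z]; first by rewrite addr_ge0.
  by rewrite mulrDl (le_trans (ler_normD _ _))// lerD.
Qed.

Lemma measurable_stdot (f : TX -> TX) : measurable_fun [set: TX] f ->
  measurable_fun [set: TX] (fun z : TX => stdot z (f z)).
Proof.
move=> mf; apply: measurable_funD.
  apply: measurable_funM; first exact: measurable_fst.
  exact: (measurableT_comp measurable_fst mf).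
apply: measurable_sum => i; apply: measurable_funM.
  exact: (measurableT_comp (@measurable_rV_coord R n i) measurable_snd).
apply: (measurableT_comp (@measurable_rV_coord R n i)).
exact: (measurableT_comp measurable_snd mf).
Qed.

Lemma bump_measurable f : bump_fun f -> measurable_fun [set: TX] (f : TX -> R).
Proof.
elim=> {f} [P|v f _ IH|c f _ IH|f g _ IHf _ IHg].
- apply: (@measurableT_comp _ _ _ _ _ _ (flat P : R -> R)).
    by apply: continuous_measurable_fun; exact: continuous_flat.
  apply: measurable_funB => //.
  exact: (@measurable_stdot id).
- apply: measurable_funM => //; exact: (@measurable_stdot (cst v)).
- exact: measurable_funM.
- exact: measurable_funD.
Qed.

End bump_algebra.

(** * Parabolic dilations and space-time cylinders *)

Section parabolic_dilation.
Context {R : realType} {n : nat}.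
Local Notation X := 'rV[R]_n.
Local Notation V := (R * 'rV[R]_n)%type.
Local Notation TX := (measurableTypeR R * 'rV[R]_n)%type.
Local Notation dx := (lebesgue_rV R n).
Local Notation dtdx := (lebesgue_measure \x lebesgue_rV R n)%E.
Implicit Types (a c d r : R) (z v w : V) (f g : V -> R).

(** The dilation under which one time derivative weighs as much as two space
    derivatives. *)
Definition dil (a : R) z : V := (a ^+ 2 * z.1, a *: z.2).

Lemma differentiable_dil a z : differentiable (dil a) z.
Proof.
apply: (@differentiable_pair _ V R X).
  apply: differentiableM; first exact: differentiable_cst.
  exact: differentiable_fst.
apply: (@differentiable_comp _ V X X snd ( *:%R a)) => //.
by apply: linear_differentiable => x; exact: cvg_snd.
Qed.

Lemma derive_dil a z w : 'D_w (dil a) z = dil a w.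
Proof.
apply: cvg_lim => //; apply: cvg_near_cst; near=> h.
have h0 : h != 0 by near: h; exact: nbhs_dnbhs_neq.
rewrite /= /dil; congr (_, _) => /=.
  by rewrite /GRing.scale/=; field.
by rewrite [a *: (_ + _)]scalerDr addrK !scalerA mulrAC mulVf// mul1r.
Unshelve. all: by end_near. Qed.

Lemma derive_comp_dil a f w z : (forall z, differentiable f z) ->
  'D_w (f \o dil a) z = 'D_(dil a w) f (dil a z).
Proof.
move=> df; have dd := differentiable_dil a z.
rewrite deriveE; last exact: differentiable_comp.
by rewrite (diff_comp dd (df _))/= -(deriveE w dd) derive_dil -deriveE.
Qed.

Lemma derive_direction_scale f c w z : differentiable f z ->
  'D_(c *: w) f z = c * 'D_w f z.
Proof. by move=> df; rewrite !deriveE// linearZ. Qed.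

(** The constant [c] is carried along so that the lemma can be iterated. *)
Lemma derive_scale_dil a c f w d w' : bump_fun f -> dil a w = d *: w' ->
  'D_w (fun z => c * f (dil a z)) = fun z => (c * d) * 'D_w' f (dil a z).
Proof.
move=> bf wd; apply/funext => z.
have df z' : differentiable f z' by exact: bump_differentiable.
have dfd : differentiable (f \o dil a) z.
  by apply: differentiable_comp => //; exact: differentiable_dil.
have E : 'D_w (f \o dil a) z = d * 'D_w' f (dil a z).
  by rewrite derive_comp_dil//= wd derive_direction_scale.
rewrite -mulrA -E.
exact: (@deriveZ R V R (f \o dil a) c z w (diff_derivable dfd)).
Qed.

Lemma dt_dil a c f : bump_fun f ->
  dt (fun z => c * f (dil a z)) = fun z => (c * a ^+ 2) * dt f (dil a z).
Proof.
move=> bf; apply: derive_scale_dil => //.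
by rewrite /dil/=; congr (_, _) => //=; rewrite !scaler0.
Qed.

Lemma laplacian_dil a c f : bump_fun f ->
  laplacian (fun z => c * f (dil a z)) =
  fun z => (c * a ^+ 2) * laplacian f (dil a z).
Proof.
move=> bf; apply/funext => z; rewrite /laplacian mulr_sumr.
apply: eq_bigr => i _.
have de : dil a (0, delta_mx ord0 i) = a *: (0, delta_mx ord0 i).
  by rewrite /dil/=; congr (_, _) => //=; rewrite mulr0 scaler0.
rewrite /dxi (derive_scale_dil _ _ _ _ _ _ bf de).
rewrite expr2 mulrA.
exact: (congr1 (@^~ z) (derive_scale_dil _ _ _ _ _ _ (bump_derive _ _ bf) de)).
Qed.

Lemma bump_iter_derive (vs : seq V) f :
  bump_fun f -> bump_fun (iter_derive vs f).
Proof. by move=> bf; elim: vs => //= v vs IH; exact: bump_derive. Qed.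

Lemma iter_derive_dil a (vs : seq V) f : bump_fun f ->
  iter_derive vs (f \o dil a) = iter_derive (map (dil a) vs) f \o dil a.
Proof.
move=> bf; elim: vs => //= v vs ->; apply/funext => z.
rewrite derive_comp_dil// => {}z; exact/bump_differentiable/bump_iter_derive.
Qed.

Lemma smooth_dil a f : bump_fun f -> smooth (f \o dil a).
Proof.
move=> bf vs; rewrite iter_derive_dil//.
have d z : differentiable (iter_derive [seq dil a i | i <- vs] f \o dil a) z.
  apply: differentiable_comp; first exact: differentiable_dil.
  exact/bump_differentiable/bump_iter_derive.
by split => [z|z v]; [exact: differentiable_continuous|exact: diff_derivable].
Qed.

Definition cube (r : R) : set X :=
  [set x | forall i, `[- r, r]%classic (x ord0 i)].

Lemma compact_cube r : compact (cube r).
Proof.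
apply: (@rV_compact _ n (fun=> `[- r, r]%classic)) => i.
exact: segment_compact.
Qed.

Lemma measurable_cube r : measurable (cube r).
Proof.
rewrite (_ : cube r =
    \bigcap_(i in [set: 'I_n]) (rV_coord i @^-1` `[- r, r]%classic)).
  apply: fin_bigcap_measurable => // i _.
  rewrite -[X in measurable X]setTI.
  by apply: measurable_rV_coord => //; exact: measurable_itv.
by apply/seteqP; split => x /= h i; [move=> _; exact: h|exact: (h i)].
Qed.

Lemma lebesgue_cube r : 0 < r -> dx (cube r) = ((2 * r) ^+ n)%:E.
Proof.
move=> r0; rewrite (@lebesgue_rV_box R n (fun=> `[- r, r]%classic)).
  rewrite lebesgue_measure_itv/= lte_fin ifT; last lra.
  rewrite -EFinB prodEFin big_const_ord iter_mulr_1.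
  by congr (_ ^+ _)%:E; lra.
by move=> i; exact: measurable_itv.
Qed.

(** Only the bottom [s] varies: [s = - r ^+ 2] contains the support of a dilated
    bump function, [s = 0] its part in the future. *)
Definition cylinder (s r : R) : set TX := `[s, r ^+ 2]%classic `*` cube r.

Lemma compact_cylinder s r : compact (cylinder s r : set V).
Proof.
by apply: compact_setX; [exact: segment_compact|exact: compact_cube].
Qed.

Lemma measurable_cylinder s r : measurable (cylinder s r).
Proof.
by apply: measurableX; [exact: measurable_itv|exact: measurable_cube].
Qed.

Lemma cylinder_future r : cylinder 0 r `<=` @future R n.
Proof. by move=> z [/=]; rewrite in_itv/= => /andP[]. Qed.

Lemma lebesgue_cylinder r : 0 < r ->
  dtdx (cylinder 0 r) = (2 ^+ n * r ^+ (n + 2))%:E.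
Proof.
move=> r0; rewrite /cylinder product_measure1E//; last exact: measurable_cube.
rewrite lebesgue_cube//.
have -> : (lebesgue_measure : {measure set _ -> \bar R})
    `[0, r ^+ 2]%classic = (r ^+ 2)%:E.
  by rewrite [LHS]lebesgue_measure_itv/= lte_fin exprn_gt0// sube0.
by rewrite -EFinM exprMn exprD mulrC mulrA.
Qed.

Lemma bump_dil_eq0 r f z : 0 < r -> bump_fun f ->
  ~ cylinder (- r ^+ 2) r z -> f (dil r^-1 z) = 0.
Proof.
move=> r0 bf zr; apply: bump_eq0 => //; rewrite leNgt; apply/negP => q0.
apply: zr; have [/= z1 z2] := ballfun_le1 _ q0; split => /=.
  move: z1; rewrite in_itv/= -ler_norml normrM ger0_norm ?sqr_ge0//.
  by rewrite exprVn ler_pdivrMl ?exprn_gt0// mulr1.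
move=> i; have := z2 i; rewrite mxE /= in_itv/= -ler_norml normrM.
by rewrite gtr0_norm ?invr_gt0// ler_pdivrMl// mulr1.
Qed.

Lemma test_fun_dil r f : 0 < r -> bump_fun f -> test_fun (f \o dil r^-1).
Proof.
move=> r0 bf; split; first exact: smooth_dil.
apply: (@subclosed_compact _ _ (cylinder (- r ^+ 2) r : set V)).
- exact: closed_closure.
- exact: compact_cylinder.
- have cc : closed (cylinder (- r ^+ 2) r : set V).
    by apply: compact_closed; [exact: norm_hausdorff|exact: compact_cylinder].
  rewrite [X in _ `<=` X](proj1 (closure_id _) cc).
  apply: closureS => z /= fz; apply: contrapT => zr; move/eqP: fz; apply.
  exact: bump_dil_eq0.
Qed.

Lemma measurable_dil a : measurable_fun [set: TX] (dil a : TX -> TX).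
Proof.
apply/measurable_fun_pairP; split.
  by apply: measurable_funM => //; exact: measurable_fst.
apply: measurable_fun_rV => i; rewrite /rV_coord /comp /dil/=.
under eq_fun do rewrite mxE.
apply: measurable_funM => //.
exact: (measurableT_comp (@measurable_rV_coord R n i) measurable_snd).
Qed.

Lemma bump_dil_measurable a f : bump_fun f ->
  measurable_fun [set: TX] (f \o dil a : TX -> R).
Proof.
move=> bf; apply: measurableT_comp (measurable_dil a).
exact: bump_measurable.
Qed.

End parabolic_dilation.

(** * Integrability against dilated bump functions *)

Lemma integrable_mul_supported {d} {T : measurableType d} {R : realType}
    (mu : {measure set T -> \bar R}) (D K : set T) (f g : T -> R) (M : R) :
  measurable D -> measurable K -> K `<=` D ->
  mu.-integrable K (EFin \o f) -> measurable_fun setT g ->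
  (forall z, `|g z| <= M) -> (forall z, D z -> ~ K z -> g z = 0) ->
  mu.-integrable D (EFin \o (fun z => f z * g z)).
Proof.
move=> mD mK KD fi mg gM g0.
have fgK : mu.-integrable K (EFin \o (fun z => f z * g z)).
  rewrite (_ : _ \o _ = (EFin \o f) \* (EFin \o g))%E; last exact/funext.
  apply: integrableMl => //; first exact: measurable_funS mg.
  exists M; split; first exact: num_real.
  by move=> N MN z _; rewrite /= (le_trans (gM z))// ltW.
apply: (@eq_integrable _ _ _ mu D mD ((EFin \o (fun z => f z * g z)) \_ K)).
  move=> z /[!inE] Dz; rewrite patchE; case: ifPn => //.
  by move/negP => Kz; rewrite /= g0 ?mulr0// => Kz'; apply: Kz; rewrite inE.
apply: (@integrableS _ _ _ mu setT) => //.
exact/(integrable_mkcond (EFin \o (fun z => f z * g z)) mK).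
Qed.

(** A threshold version of Young's inequality: above [tau],
    [y = y `^ (1 - p) * y `^ p] with [y `^ (1 - p) <= tau `^ (1 - p)]. *)
Lemma le_powR_add {R : realType} (p tau y : R) : 1 < p -> 0 < tau -> 0 <= y ->
  y <= tau `^ (1 - p) * y `^ p + tau.
Proof.
move=> p1 t0 y0; have [yt|ty] := leP y tau.
  by rewrite (le_trans yt)// lerDr mulr_ge0// powR_ge0.
have {}y0 : 0 < y by apply: lt_trans ty.
rewrite ler_wpDr//; first exact: ltW.
have {1}-> : y = y `^ (1 - p) * y `^ p.
  by rewrite -powRD ?subrK ?powRr1 ?ltW// (gt_eqF y0) implybT.
rewrite ler_wpM2r ?powR_ge0// -[1 - p]opprB !powRN lef_pV2 ?posrE ?powR_gt0//.
by apply: ge0_ler_powR; rewrite ?nnegrE ?subr_ge0; lra.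
Qed.

(** The threshold [tau = lam * a `^ (N - m)] is chosen so that [a ^+ m * tau] is
    exactly [lam * a ^+ N]; the last hypothesis says that the power of [a] left
    in front of [y `^ p] is nonnegative. In the application [a = 1 / r] and
    [N = n + 2]. *)
Lemma scaled_le_powR_add {R : realType} (m N : nat) (p a lam y : R) :
  1 < p -> 0 < a <= 1 -> 0 < lam -> 0 <= y ->
  (N%:R - m%:R) * (p - 1) <= m%:R ->
  a ^+ m * y <= lam `^ (1 - p) * y `^ p + lam * a ^+ N.
Proof.
move=> p1 /andP[a0 a1] l0 y0 mp; set s : R := N%:R - m%:R.
have aD (u v : R) : a `^ (u + v) = a `^ u * a `^ v.
  by rewrite powRD// (gt_eqF a0) implybT.
have am k : a ^+ k = a `^ k%:R by rewrite powR_mulrn// ltW.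
have t0 : 0 < lam * a `^ s by rewrite mulr_gt0// powR_gt0.
have := le_powR_add p _ y p1 t0 y0.
rewrite -(@ler_pM2l _ (a ^+ m)) ?exprn_gt0// => /le_trans; apply.
rewrite mulrDr; apply: lerD; last first.
  by rewrite mulrCA !am -aD addrC subrK.
rewrite (powRM _ (ltW l0)) ?powR_ge0// -powRrM mulrA mulrCA -mulrA.
rewrite ler_wpM2l ?powR_ge0// ler_piMl ?powR_ge0// am -aD.
rewrite -[leRHS](powRr0 a) ger_powR ?a0//.
have -> : s * (1 - p) = - (s * (p - 1)) by lra.
by rewrite subr_ge0.
Qed.

(** Provides the large [lam] of the absorption step, as [1 - p < 0]. *)
Lemma powR_le_exists {R : realType} (p e : R) : 1 < p -> 0 < e ->
  exists2 lam : R, 0 < lam & lam `^ (1 - p) <= e.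
Proof.
move=> p1 e0; exists (e `^ (1 - p)^-1); first exact: powR_gt0.
have p0 : 1 - p != 0 by rewrite lt_eqF// subr_lt0.
by rewrite -powRrM mulVf// powRr1// ltW.
Qed.

Section spacetime_integrals.
Context {R : realType} {n : nat}.
Local Notation X := 'rV[R]_n.
Local Notation V := (R * 'rV[R]_n)%type.
Local Notation TX := (measurableTypeR R * 'rV[R]_n)%type.
Local Notation dx := (lebesgue_rV R n).
Local Notation dtdx := (lebesgue_measure \x lebesgue_rV R n)%E.
Local Notation future := (@future R n).
Implicit Types (f g u v w F : V -> R).

Lemma measurable_future : measurable future.
Proof.
rewrite (_ : future = `[0, +oo[%classic `*` setT).
  by apply: measurableX => //; exact: measurable_itv.
by apply/seteqP; split => z /=; rewrite in_itv/= andbT; [split|case].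
Qed.

Lemma bump_bounded f : bump_fun f ->
  exists2 C, 0 <= C & forall z, `|f z| <= C.
Proof.
move=> bf; have [|C C0 HC] := bump_le_powR f (1 / 2) _ bf; first lra.
exists C => // z; rewrite (le_trans (HC z))// ler_piMr//.
have E : 1 `^ (1 / 2) = 1 :> R by rewrite powR1.
rewrite -[leRHS]E; apply: ge0_ler_powR; rewrite ?nnegrE ?flat_ge0//.
exact: flat_le1.
Qed.

Lemma Lploc_powR_integrable p w r : Lploc p w ->
  dtdx.-integrable (cylinder 0 r) (EFin \o (fun z => `|w z| `^ p)).
Proof.
move=> [mw wp]; apply/integrableP; split.
  apply/measurable_EFinP.
  apply: (@measurableT_comp _ _ _ _ _ _ (fun x : R => x `^ p) _
    (fun z : TX => `|w z|)); first exact: measurable_powR.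
  apply: (measurableT_comp _ _) => //; apply: measurable_funS mw.
    exact: measurable_future.
  exact: cylinder_future.
under eq_integral do rewrite gee0_abs ?lee_fin ?powR_ge0//.
by apply: wp; [exact: cylinder_future|exact: compact_cylinder].
Qed.

Lemma cst_integrable_cylinder (c r : R) : 0 < r ->
  dtdx.-integrable (cylinder 0 r) (EFin \o cst c).
Proof.
move=> r0; apply/integrableP; split; first exact/measurable_EFinP.
rewrite [ltLHS](_ : _ = \int[dtdx]_(x in cylinder 0 r) (cst `|c|%:E x))%E//.
rewrite integral_cst; last exact: measurable_cylinder.
by rewrite [X in (_ * X)%E](lebesgue_cylinder r r0) -EFinM ltry.
Qed.

Lemma Lploc_integrable p w r : 1 <= p -> 0 < r -> Lploc p w ->
  dtdx.-integrable (cylinder 0 r) (EFin \o w).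
Proof.
move=> p1 r0 wp.
apply: (@le_integrable _ _ _ _ _ (measurable_cylinder 0 r) _
  (EFin \o (fun z => 1 + `|w z| `^ p))).
- apply/measurable_EFinP; apply: measurable_funS (wp.1).
    exact: measurable_future.
  exact: cylinder_future.
- move=> z _ /=; rewrite lee_fin [leRHS]ger0_norm ?addr_ge0 ?powR_ge0//.
  have [w1|w1] := leP `|w z| 1; first by rewrite (le_trans w1)// lerDl powR_ge0.
  by rewrite (le_trans (le1r_powR (ltW w1) p1))// lerDr.
- rewrite (_ : EFin \o _ = (EFin \o cst (1 : R)%R) \+
    (EFin \o (fun z => (`|w z| `^ p)%R)))%E; last exact/funext.
  apply: integrableD; [exact: measurable_cylinder| |].
  - exact: cst_integrable_cylinder.
  - exact: Lploc_powR_integrable.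
Qed.

Lemma integrable_mul_bump_dil w f r : 0 < r -> bump_fun f ->
  dtdx.-integrable (cylinder 0 r) (EFin \o w) ->
  dtdx.-integrable future (EFin \o (fun z => w z * f (dil r^-1 z))).
Proof.
move=> r0 bf wi; have [C C0 fC] := bump_bounded _ bf.
apply: (@integrable_mul_supported _ _ _ _ _ (cylinder 0 r) w
  (f \o dil r^-1) C) => //.
- exact: measurable_future.
- exact: measurable_cylinder.
- exact: cylinder_future.
- exact: bump_dil_measurable.
- by move=> z; exact: fC.
- move=> z z0 zr; apply: bump_dil_eq0 => // -[/= z1 z2]; apply: zr.
  split => //=.
  move: z0 z1; rewrite /future/= !in_itv/= => -> /andP[_ ->].
  by [].
Qed.

End spacetime_integrals.

(** * Estimates of the rescaled right-hand side *)

Section weighted_test_functions.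
Context {R : realType} {n : nat}.
Local Notation X := 'rV[R]_n.
Local Notation V := (R * 'rV[R]_n)%type.
Local Notation TX := (measurableTypeR R * 'rV[R]_n)%type.
Local Notation dtdx := (lebesgue_measure \x lebesgue_rV R n)%E.
Local Notation future := (@future R n).

Definition profile (z : V) : R := flat 1 (ballfun z).

Lemma bump_profile : bump_fun profile. Proof. exact: bump_flat. Qed.

Definition cutoff (r : R) : V -> R := profile \o dil r^-1.

Variables (w F G : V -> R) (p c : R) (m : nat).
Hypotheses (p1 : 1 < p) (c0 : 0 < c) (m0 : (0 < m)%N) (bG : bump_fun G).
Hypothesis wp : Lploc p w.
Hypothesis wF : forall z, c * `|w z| `^ p <= F z.
Hypothesis iF : forall r, 0 < r -> dtdx.-integrable (cylinder 0 r) (EFin \o F).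
Hypothesis critical : ((n + 2)%:R - m%:R) * (p - 1) <= m%:R.

Let h (r : R) (z : V) := r^-1 ^+ m * (`|w z| * `|G (dil r^-1 z)|).

(** The part of [h r z] above the constant [lam * r^-1 ^+ (n + 2)].
    The indicator function, which is 1 wherever [h r z] is nonzero in the
    future, makes the subtracted term integrable, with an integral independent
    of [r]. *)
Definition excess (lam r : R) (z : V) : R :=
  Num.max 0 (h r z - lam * r^-1 ^+ (n + 2) * \1_(cylinder 0 r) z).

Let F_ge0 z : 0 <= F z.
Proof. by apply: le_trans (wF z); rewrite mulr_ge0 ?powR_ge0// ltW. Qed.

Lemma cutoff_ge0 r z : 0 <= cutoff r z. Proof. exact: flat_ge0. Qed.

Lemma cutoff_le1 r z : cutoff r z <= 1. Proof. exact: flat_le1. Qed.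

Let h_ge0 r z : 0 < r -> 0 <= h r z.
Proof. by move=> r0; rewrite mulr_ge0 ?exprn_ge0 ?invr_ge0 ?mulr_ge0// ltW. Qed.

Let h_eq0 r z : 0 < r -> future z -> ~ cylinder 0 r z -> h r z = 0.
Proof.
move=> r0 z0 zr; rewrite /h bump_dil_eq0// ?normr0 ?mulr0//.
move=> -[/= z1 z2]; apply: zr; split => //=.
by move: z0 z1; rewrite /Defs.future/= !in_itv/= => -> /andP[_ ->].
Qed.

Lemma excess_ge0 lam r z : 0 <= excess lam r z.
Proof. by rewrite /excess le_max lexx. Qed.

(** With [y = |w| |G|], the threshold estimate leaves [y `^ p], and
    [|G| <= C cutoff^(1 / p)] turns it into [|w|^p cutoff], which [F] controls.
    Outside of the cylinder, [G] vanishes. *)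
Lemma excess_le : exists2 C, 0 <= C &
  forall lam r z, 0 < lam -> 1 <= r -> future z ->
    excess lam r z <= C * lam `^ (1 - p) * (F z * cutoff r z).
Proof.
have p0 : 0 < p by exact: lt_trans ltr01 p1.
have [|C C0 GC] := bump_le_powR G p^-1 _ bG; first by rewrite invf_lt1.
exists (C `^ p * c^-1); first by rewrite mulr_ge0 ?powR_ge0// invr_ge0 ltW.
move=> lam r z l0 r1 z0; have r0 : 0 < r by lra.
have rhs0 : 0 <= C `^ p / c * lam `^ (1 - p) * (F z * cutoff r z).
  by rewrite !mulr_ge0 ?powR_ge0 ?cutoff_ge0// invr_ge0 ltW.
rewrite /excess ge_max rhs0/=.
have [zr|zr] := pselect (cylinder 0 r z); last first.
  rewrite h_eq0// sub0r (le_trans _ rhs0)// oppr_le0.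
  by rewrite !mulr_ge0 ?exprn_ge0 ?invr_ge0// ltW.
rewrite indicE mem_set// mulr1 lerBlDr.
set y := `|w z| * `|G (dil r^-1 z)|.
have y0 : 0 <= y by rewrite mulr_ge0.
apply: le_trans
  (scaled_le_powR_add m (n + 2) p r^-1 lam y p1 _ l0 y0 critical) _.
  by rewrite invr_gt0 r0 invf_le1.
rewrite lerD2r.
have yp : y `^ p <= C `^ p * (`|w z| `^ p * cutoff r z).
  rewrite powRM// mulrCA ler_wpM2l ?powR_ge0//.
  have -> : cutoff r z = (cutoff r z `^ p^-1) `^ p.
    by rewrite -powRrM mulVf ?powRr1 ?cutoff_ge0// gt_eqF.
  rewrite -powRM ?powR_ge0//; apply: ge0_ler_powR => //.
  - exact: ltW.
  - by rewrite nnegrE mulr_ge0 ?powR_ge0.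
have wF' : `|w z| `^ p <= c^-1 * F z by rewrite ler_pdivlMl.
rewrite mulrAC [leLHS]mulrC ler_wpM2r ?powR_ge0// (le_trans yp)//.
rewrite -mulrA ler_wpM2l ?powR_ge0// mulrA ler_wpM2r ?cutoff_ge0//.
Qed.

Let iw r : 0 < r -> dtdx.-integrable (cylinder 0 r) (EFin \o w).
Proof. by move=> r0; apply: Lploc_integrable wp => //; exact: ltW. Qed.

Lemma integrable_mul_scaled_bump r : 0 < r ->
  dtdx.-integrable future
    (EFin \o (fun z => w z * (r^-1 ^+ m * G (dil r^-1 z)))).
Proof.
move=> r0; apply: (@integrable_mul_bump_dil _ _ w (fun z => r^-1 ^+ m * G z)).
- exact: r0.
- exact: bump_scale.
- exact: iw.
Qed.

Let h_integrable r : 0 < r -> dtdx.-integrable future (EFin \o h r).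
Proof.
move=> r0; have := integrable_norm (integrable_mul_scaled_bump r r0).
congr (dtdx.-integrable future _); apply/funext => z /=.
rewrite !normrM (ger0_norm (exprn_ge0 _ _)) ?invr_ge0 ?ltW//.
by rewrite /h mulrCA.
Qed.

Let measurable_indic_cylinder r :
  measurable_fun [set: TX] (\1_(cylinder 0 r) : TX -> R).
Proof. by apply: measurable_indic; exact: measurable_cylinder. Qed.

Lemma excess_integrable lam r : 0 < lam -> 0 < r ->
  dtdx.-integrable future (EFin \o excess lam r).
Proof.
move=> l0 r0; have hi := h_integrable r r0.
apply: (@le_integrable _ _ _ _ _ measurable_future _ (EFin \o h r)) => //.
- apply/measurable_EFinP; apply: measurable_maxr => //.
  apply: measurable_funB.
    by move/measurable_int : hi => /measurable_EFinP.
  apply: measurable_funM => //.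
  exact: measurable_funTS (measurable_indic_cylinder r).
- move=> z _ /=; rewrite lee_fin !ger0_norm ?excess_ge0 ?h_ge0//.
  rewrite /excess ge_max h_ge0//= gerBl.
  by rewrite !mulr_ge0 ?exprn_ge0 ?invr_ge0// ltW.
Qed.

Let indic_integrable (a r : R) : 0 < r ->
  dtdx.-integrable future (EFin \o (fun z => a * \1_(cylinder 0 r) z)) /\
  \int[dtdx]_(z in future) (a * \1_(cylinder 0 r) z) =
    a * (2 ^+ n * r ^+ (n + 2)).
Proof.
move=> r0.
have Ir : dtdx.-integrable future (EFin \o (\1_(cylinder 0 r) : TX -> R)).
  apply/integrableP; split.
    apply/measurable_EFinP.
    exact: measurable_funTS (measurable_indic_cylinder r).
  under eq_integral do rewrite gee0_abs ?lee_fin//.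
  rewrite integral_indic//;
    [|exact: measurable_future|exact: measurable_cylinder].
  rewrite setIidl; last exact: cylinder_future.
  by rewrite [ltLHS](lebesgue_cylinder r r0) ltry.
split.
  exact: (integrableZl measurable_future a Ir).
rewrite RintegralZl//; last exact: measurable_future.
congr (_ * _); rewrite /Rintegral integral_indic//;
  [|exact: measurable_future|exact: measurable_cylinder].
rewrite setIidl; last exact: cylinder_future.
by rewrite [X in fine X](lebesgue_cylinder r r0).
Qed.

Lemma normr_Rintegral_le_excess lam r : 0 < lam -> 0 < r ->
  `|\int[dtdx]_(z in future) (w z * (r^-1 ^+ m * G (dil r^-1 z)))| <=
  \int[dtdx]_(z in future) excess lam r z + lam * 2 ^+ n.
Proof.
move=> l0 r0; have mfut := @measurable_future R n.
apply: le_trans (le_normr_Rintegral mfut (integrable_mul_scaled_bump r r0)) _.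
have [I1 I2] := indic_integrable (lam * r^-1 ^+ (n + 2)) r r0.
have -> : lam * 2 ^+ n = lam * r^-1 ^+ (n + 2) * (2 ^+ n * r ^+ (n + 2)).
  rewrite exprVn; field.
  by rewrite expf_neq0// gt_eqF.
have ei := excess_integrable lam r l0 r0.
rewrite -I2 -RintegralD//.
apply: le_Rintegral => //.
- exact: integrable_norm (integrable_mul_scaled_bump r r0).
- exact: (integrableD mfut ei I1).
move=> z _; rewrite -lerBlDr le_max; apply/orP; right.
rewrite lerD2r !normrM (ger0_norm (exprn_ge0 _ _)) ?invr_ge0 ?(ltW r0)//.
by rewrite /h mulrCA.
Qed.

Lemma weighted_integrable r : 0 < r ->
  dtdx.-integrable future (EFin \o (fun z => F z * cutoff r z)).
Proof.
move=> r0; apply: (@integrable_mul_bump_dil _ _ F profile).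
- exact: r0.
- exact: bump_profile.
- exact: iF.
Qed.

(** Taking [lam] large makes the coefficient [C * lam `^ (1 - p)] of the excess
    smaller than [e], at the price of a large constant [M = lam * 2 ^+ n]. *)
Lemma absorption e : 0 < e -> exists M, forall r, 1 <= r ->
  `|\int[dtdx]_(z in future) (w z * (r^-1 ^+ m * G (dil r^-1 z)))| <=
  e * \int[dtdx]_(z in future) (F z * cutoff r z) + M.
Proof.
move=> e0; have mfut := @measurable_future R n.
have [C C0 HC] := excess_le.
have [|lam l0 lC] := powR_le_exists p (e / (C + 1)) p1.
  by rewrite divr_gt0//; lra.
exists (lam * 2 ^+ n) => r r1; have r0 : 0 < r by lra.
apply: le_trans (normr_Rintegral_le_excess lam r l0 r0) _.
rewrite lerD2r -RintegralZl//; last exact: weighted_integrable.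
apply: le_Rintegral => //.
- exact: excess_integrable.
- exact: (integrableZl mfut e (weighted_integrable r r0)).
move=> z z0; apply: le_trans (HC lam r z l0 r1 z0) _.
rewrite ler_wpM2r ?mulr_ge0 ?cutoff_ge0//.
apply: (@le_trans _ _ (C * (e / (C + 1)))); first by rewrite ler_wpM2l.
have C1 : 0 < C + 1 by exact: ltr_wpDl.
by rewrite mulrCA ler_piMr ?(ltW e0)// ler_pdivrMr// mul1r lerDl.
Qed.

(** For fixed [lam] the excess is dominated by a multiple of the integrable [F]
    and bounded pointwise by a multiple of [1 / r], so its integral tends to 0;
    what remains is [lam * 2 ^+ n] with [lam] arbitrary. *)
Lemma vanishing : dtdx.-integrable future (EFin \o F) ->
  \int[dtdx]_(z in future)
    (w z * (k.+1%:R^-1 ^+ m * G (dil k.+1%:R^-1 z))) @[k --> \oo] --> (0 : R).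
Proof.
move=> Fi; have mfut := @measurable_future R n.
have [C C0 HC] := excess_le.
have [D D0 HD] := bump_bounded _ bG.
have k1 k : 1 <= k.+1%:R :> R by rewrite ler1n.
have k0 k : 0 < k.+1%:R :> R by rewrite ltr0n.
have excess_cvg0 lam : 0 < lam ->
    \int[dtdx]_(z in future) excess lam k.+1%:R z @[k --> \oo] --> (0 : R).
  move=> l0.
  have [|||||_ _] := @dominated_convergence _ TX R dtdx future mfut
      (fun k => EFin \o excess lam k.+1%:R) (cst 0%E)
      (EFin \o (fun z => C * lam `^ (1 - p) * F z)).
  - by move=> k; apply: measurable_int; exact: excess_integrable.
  - exact: measurable_cst.
  - apply/aeW => z z0; apply: cvg_EFin; first by apply/nearW.
    apply: (@squeeze_cvgr _ _ _ _ (cst 0) (fun k => `|w z| * D * k.+1%:R^-1)).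
    + near=> k; rewrite /= excess_ge0/= /excess ge_max !mulr_ge0//=.
      rewrite (@le_trans _ _ (h k.+1%:R z))//.
        by rewrite gerBl !mulr_ge0 ?exprn_ge0 ?invr_ge0// ltW.
      rewrite /h mulrC ler_pM ?exprn_ge0 ?invr_ge0 ?mulr_ge0// ?ler_wpM2l//.
      rewrite -[leRHS]expr1 ler_wiXn2l// ?invr_ge0//.
      by rewrite invf_le1.
    + exact: cvg_cst.
    + rewrite -[X in _ --> X](mulr0 (`|w z| * D)).
      by apply: cvgM; [exact: cvg_cst|exact: cvg_harmonic].
  - exact: (integrableZl mfut (C * lam `^ (1 - p)) Fi).
  - apply/aeW => z k z0; rewrite /= lee_fin ger0_norm ?excess_ge0//.
    apply: le_trans (HC lam _ z l0 (k1 k) z0) _.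
    by rewrite ler_wpM2l ?mulr_ge0 ?powR_ge0// ler_piMr ?cutoff_le1.
  rewrite integral0; exact: fine_cvg.
apply/cvgr0Pnorm_le => e e0.
pose lam := e / 2 / 2 ^+ n.
have l0 : 0 < lam by rewrite !divr_gt0// exprn_gt0.
have e2 : 0 < e / 2 by rewrite divr_gt0.
have /cvgr0Pnorm_le/(_ _ e2) := excess_cvg0 _ l0.
apply: filterS => k ek.
apply: le_trans (normr_Rintegral_le_excess lam _ l0 (k0 k)) _.
rewrite [lam * _]divfK ?expf_neq0// [leRHS](splitr e) lerD2r.
exact: le_trans (ler_norm _) ek.
Unshelve. all: by end_near. Qed.

End weighted_test_functions.

(** * Limits at large scales *)

(** Fatou's lemma for [F z * g k z], which converges to [F z * l]. *)
Lemma integrable_weight_limit {d} {T : measurableType d} {R : realType}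
    (mu : {measure set T -> \bar R}) (D : set T) (F : T -> R)
    (g : nat -> T -> R) (l B : R) :
  measurable D -> measurable_fun D F -> (forall z, 0 <= F z) ->
  (forall k z, 0 <= g k z) ->
  (forall k, mu.-integrable D (EFin \o (fun z => F z * g k z))) ->
  0 < l -> (forall z, g k z @[k --> \oo] --> l) ->
  (forall k, \int[mu]_(z in D) (F z * g k z) <= B) ->
  mu.-integrable D (EFin \o F).
Proof.
move=> mD mF F0 g0 Fg l0 gl FB.
suff Fl : mu.-integrable D (EFin \o (fun z => F z * l)).
  have := integrableZl mD l^-1 Fl; congr (mu.-integrable D _).
  by apply/funext => z /=; rewrite -EFinM mulrCA mulVf ?mulr1// gt_eqF.
apply/integrableP; split.
  by apply/measurable_EFinP; apply: measurable_funM.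
apply: (@le_lt_trans _ _ B%:E); last exact: ltry.
pose u k z := (F z * g k z)%:E.
have ul z : u k z @[k --> \oo] --> (F z * l)%:E.
  apply: cvg_EFin; first by apply/nearW.
  by apply: cvgM; [exact: cvg_cst|exact: gl].
rewrite (eq_integral (fun z => limn_einf (u ^~ z))); last first.
  move=> z _; rewrite /= ger0_norm ?mulr_ge0// ?ltW//.
  rewrite is_cvg_limn_einfE; first exact/esym/cvg_lim.
  by apply/cvg_ex; exists (F z * l)%:E.
apply: le_trans; first apply: fatou => //.
- by move=> k; exact: (measurable_int mu (Fg k)).
- by move=> k z _; rewrite lee_fin mulr_ge0.
rewrite limn_einf_lim; apply: lime_le; first exact: is_cvg_einfs.
apply: nearW => k.
apply: (@le_trans _ _ (\int[mu]_(z in D) u k z)%E).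
  by apply: ereal_inf_lbound; exists k => /=.
rewrite -(@fineK _ (\int[mu]_(z in D) u k z)%E) ?lee_fin; first exact: FB.
exact: integrable_fin_num (Fg k).
Qed.

Section large_scale_limits.
Context {R : realType} {n : nat}.
Local Notation X := 'rV[R]_n.
Local Notation V := (R * 'rV[R]_n)%type.
Local Notation TX := (measurableTypeR R * 'rV[R]_n)%type.
Local Notation dx := (lebesgue_rV R n).
Local Notation dtdx := (lebesgue_measure \x lebesgue_rV R n)%E.
Local Notation future := (@future R n).

Lemma cutoff_cvg (z : V) : cutoff k.+1%:R z @[k --> \oo] --> flat 1 (1 : R).
Proof.
rewrite /cutoff /profile /comp; apply: continuous_cvg.
  exact: continuous_flat.
have a0 : (k.+1%:R^-1 : R) @[k --> \oo] --> (0 : R) by exact: cvg_harmonic.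
have a20 : (k.+1%:R^-1 ^+ 2 : R) @[k --> \oo] --> (0 : R).
  by rewrite -[X in _ --> X](mulr0 0); apply: cvgM.
rewrite -[X in _ --> X](subr0 1); apply: cvgB; first exact: cvg_cst.
rewrite (_ : (fun _ => _) = (fun k => k.+1%:R^-1 ^+ 2 *
    (k.+1%:R^-1 ^+ 2 * (z.1 * z.1) + dotv z.2 z.2))); last first.
  apply/funext => k; rewrite /stdot /dil /= mulrDr.
  congr (_ + _); first by ring.
  rewrite /dotv mulr_sumr; apply: eq_bigr => i _; rewrite !mxE; ring.
rewrite -[X in _ --> X](mul0r (0 * (z.1 * z.1) + dotv z.2 z.2)).
apply: cvgM => //; apply: cvgD; last exact: cvg_cst.
by apply: cvgM => //; exact: cvg_cst.
Qed.

Lemma flat11_gt0 : 0 < flat 1 (1 : R).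
Proof. by rewrite /flat ltr01 hornerC mul1r expR_gt0. Qed.

Lemma measurable_slice (t : R) : measurable_fun [set: X] (fun x => (t, x) : TX).
Proof.
apply/measurable_fun_pairP.
by split; [exact: measurable_cst|exact: measurable_id].
Qed.

Lemma L1loc_mul_bump_dil (f : X -> R) (K : V -> R) r : 0 < r -> bump_fun K ->
  L1loc f -> dx.-integrable setT (EFin \o (fun x => f x * K (dil r^-1 (0, x)))).
Proof.
move=> r0 bK fL; have [C C0 KC] := bump_bounded _ bK.
apply: (@integrable_mul_supported _ _ _ _ _ (cube r) f
  (fun x => K (dil r^-1 (0, x))) C) => //.
- exact: measurable_cube.
- by apply: fL; exact: compact_cube.
- exact: (measurableT_comp (bump_dil_measurable r^-1 K bK)
    (measurable_slice 0)).
- by move=> x _ xr; apply: bump_dil_eq0 => // -[_].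
Qed.

Lemma data_cvg (f : X -> R) : dx.-integrable setT (EFin \o f) ->
  \int[dx]_x (f x * cutoff k.+1%:R (0, x)) @[k --> \oo] -->
  flat 1 (1 : R) * \int[dx]_x f x.
Proof.
move=> fi; rewrite mulrC -RintegralZr//.
have mf : measurable_fun setT f.
  by apply/measurable_EFinP; exact: measurable_int fi.
have mcutoff k : measurable_fun setT (fun x : X => cutoff k.+1%:R (0, x)).
  exact: (measurableT_comp (bump_dil_measurable k.+1%:R^-1 _ bump_profile)
    (measurable_slice 0)).
have [|||||fl _] := @dominated_convergence _ X R dx setT measurableT
    (fun k => EFin \o (fun x => f x * cutoff k.+1%:R (0, x)))
    (EFin \o (fun x => f x * flat 1 1)) (abse \o (EFin \o f)).
- by move=> k; apply/measurable_EFinP; exact: measurable_funM.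
- by apply/measurable_EFinP; exact: measurable_funM.
- apply/aeW => x _; apply: cvg_EFin; first by apply/nearW.
  by apply: cvgM; [exact: cvg_cst|exact: cutoff_cvg].
- exact: integrable_abse.
- apply/aeW => x k _; rewrite /= lee_fin normrM ler_piMr//.
  rewrite ger0_norm ?cutoff_ge0//.
  exact: cutoff_le1.
move=> H; apply: fine_cvg; rewrite fineK; first exact: H.
exact: integrable_fin_num.
Qed.

(** A term with zero coefficient vanishes whatever [v] is, even when [v] is not
    measurable. *)
Lemma Lploc_source_term (p c : R) (v : V -> R) : 0 <= c ->
  (0 < c -> Lploc p v) ->
  measurable_fun future (fun z => c * `|v z| `^ p) /\
  forall r, 0 < r ->
    dtdx.-integrable (cylinder 0 r) (EFin \o (fun z => c * `|v z| `^ p)).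
Proof.
rewrite le_eqVlt => /predU1P[<- _|c0 /(_ c0) vp].
  under eq_fun do rewrite mul0r.
  by split => [|r r0]; [exact: measurable_cst|exact: cst_integrable_cylinder].
split => [|r r0]; last first.
  exact: (integrableZl (measurable_cylinder 0 r) c
    (Lploc_powR_integrable _ _ _ vp)).
apply: measurable_funM => //.
apply: (@measurableT_comp _ _ _ _ _ _ (fun x : R => x `^ p) _
  (fun z : TX => `|v z|)); first exact: measurable_powR.
by apply: (measurableT_comp _ _) => //; exact: vp.1.
Qed.

Lemma source_ge (p c1 c2 c3 c4 : R) (u v w theta : V -> R) z :
  0 <= c1 -> 0 <= c2 -> 0 <= c3 -> 0 <= c4 ->
  let f := source p c1 c2 c3 c4 u v w theta in
  [/\ 0 <= f z, c1 * `|u z| `^ p <= f z & c4 * `|theta z| `^ p <= f z].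
Proof.
move=> h1 h2 h3 h4; rewrite /= /source.
have := mulr_ge0 h1 (powR_ge0 `|u z| p).
have := mulr_ge0 h2 (powR_ge0 `|v z| p).
have := mulr_ge0 h3 (powR_ge0 `|w z| p).
have := mulr_ge0 h4 (powR_ge0 `|theta z| p).
by split; lra.
Qed.

Lemma integrable_source (p c1 c2 c3 c4 : R) (u v w theta : V -> R) :
  0 <= c1 -> 0 <= c2 -> 0 <= c3 -> 0 <= c4 ->
  (0 < c1 -> Lploc p u) -> (0 < c2 -> Lploc p v) ->
  (0 < c3 -> Lploc p w) -> (0 < c4 -> Lploc p theta) ->
  let f := source p c1 c2 c3 c4 u v w theta in
  measurable_fun future f /\
  forall r, 0 < r -> dtdx.-integrable (cylinder 0 r) (EFin \o f).
Proof.
move=> h1 h2 h3 h4 /(Lploc_source_term _ _ _ h1)[m1 i1].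
move=> /(Lploc_source_term _ _ _ h2)[m2 i2].
move=> /(Lploc_source_term _ _ _ h3)[m3 i3].
move=> /(Lploc_source_term _ _ _ h4)[m4 i4] f; split.
  by do 3 apply: measurable_funD => //.
move=> r r0; have mc := @measurable_cylinder R n 0 r.
exact: (integrableD mc (integrableD mc (integrableD mc
  (i1 r r0) (i2 r r0)) (i3 r r0)) (i4 r r0)).
Qed.

End large_scale_limits.

(** * The sum of the two equations *)

Section summed_equation.
Context {R : realType} {n : nat}.
Local Notation X := 'rV[R]_n.
Local Notation V := (R * 'rV[R]_n)%type.
Local Notation TX := (measurableTypeR R * 'rV[R]_n)%type.
Local Notation dx := (lebesgue_rV R n).
Local Notation dtdx := (lebesgue_measure \x lebesgue_rV R n)%E.
Local Notation future := (@future R n).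

(** The factor of [u] in the summed equation: [dt^2 + laplacian^2] comes from
    the first equation and [laplacian dt] from the second. Parabolic
    dilations give its three terms the same weight. *)
Definition plate_adjoint : V -> R := fun z =>
  dt (dt profile) z + laplacian (laplacian profile) z +
  laplacian (dt profile) z.

Lemma bump_plate_adjoint : bump_fun plate_adjoint.
Proof.
have b := @bump_profile R n.
apply: bump_add; first apply: bump_add.
- by do 2 apply: bump_dt.
- by do 2 apply: bump_laplacian.
- by apply: bump_laplacian; exact: bump_dt.
Qed.

(** The first equation contributes [theta * laplacian Psi] and the second
    [theta * (- dt Psi - laplacian Psi)], so that only [- theta * dt Psi]
    survives. The integrals being real-valued, each splitting needs the
    integrability of its pieces. *)
Lemma summed_equation (f1 f2 u theta : V -> R) (u0 u1 theta0 : X -> R) (r : R) :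
  0 < r ->
  (forall s, 0 < s -> dtdx.-integrable (cylinder 0 s) (EFin \o f1)) ->
  (forall s, 0 < s -> dtdx.-integrable (cylinder 0 s) (EFin \o f2)) ->
  (forall s, 0 < s -> dtdx.-integrable (cylinder 0 s) (EFin \o u)) ->
  (forall s, 0 < s -> dtdx.-integrable (cylinder 0 s) (EFin \o theta)) ->
  L1loc u0 -> L1loc u1 -> L1loc theta0 ->
  {ae dx, forall x, u0 x = 0} ->
  (forall Psi, test_fun Psi ->
    \int[dtdx]_(z in future) (f1 z * Psi z) +
    \int[dx]_x (- u0 x * dt Psi (0, x) + u1 x * Psi (0, x)) =
    \int[dtdx]_(z in future)
      (u z * (dt (dt Psi) z + laplacian (laplacian Psi) z)) +
    \int[dtdx]_(z in future) (theta z * laplacian Psi z)) ->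
  (forall Psi, test_fun Psi ->
    \int[dtdx]_(z in future) (f2 z * Psi z) +
    \int[dx]_x (- u0 x * laplacian Psi (0, x) + theta0 x * Psi (0, x)) =
    \int[dtdx]_(z in future) (theta z * (- dt Psi z - laplacian Psi z)) +
    \int[dtdx]_(z in future) (u z * laplacian (dt Psi) z)) ->
  \int[dtdx]_(z in future) ((f1 z + f2 z) * cutoff r z) +
  \int[dx]_x ((u1 x + theta0 x) * cutoff r (0, x)) =
  \int[dtdx]_(z in future) (u z * (r^-1 ^+ 4 * plate_adjoint (dil r^-1 z))) -
  \int[dtdx]_(z in future) (theta z * (r^-1 ^+ 2 * dt profile (dil r^-1 z))).
Proof.
move=> r0 if1 if2 iu ith iu0 iu1 ith0 u00 eq1 eq2.
have mfut := @measurable_future R n.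
have bp := @bump_profile R n; set a := r^-1.
have tp : test_fun (cutoff r : V -> R) by exact: (test_fun_dil r profile r0 bp).
have cutoffE : cutoff r = fun z : V => 1 * profile (dil a z).
  by apply/funext => z; rewrite mul1r.
have dtE : dt (cutoff r) = fun z : V => a ^+ 2 * dt profile (dil a z).
  by rewrite cutoffE dt_dil// mul1r.
have lapE : laplacian (cutoff r) =
    fun z : V => a ^+ 2 * laplacian profile (dil a z).
  by rewrite cutoffE laplacian_dil// mul1r.
have a4 : a ^+ 2 * a ^+ 2 = a ^+ 4 by rewrite -exprD.
have dtdtE : dt (dt (cutoff r)) =
    fun z : V => a ^+ 4 * dt (dt profile) (dil a z).
  rewrite -a4; apply: etrans (congr1 (@dt R n) dtE) _.
  exact: (dt_dil a (a ^+ 2) (dt profile) (bump_dt _ bp)).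
have laplapE : laplacian (laplacian (cutoff r)) =
    fun z : V => a ^+ 4 * laplacian (laplacian profile) (dil a z).
  rewrite -a4; apply: etrans (congr1 (@laplacian R n) lapE) _.
  exact: (laplacian_dil a (a ^+ 2) (laplacian profile) (bump_laplacian _ bp)).
have lapdtE : laplacian (dt (cutoff r)) =
    fun z : V => a ^+ 4 * laplacian (dt profile) (dil a z).
  rewrite -a4; apply: etrans (congr1 (@laplacian R n) dtE) _.
  exact: (laplacian_dil a (a ^+ 2) (dt profile) (bump_dt _ bp)).
have II (f K : V -> R) c :
    (forall s, 0 < s -> dtdx.-integrable (cylinder 0 s) (EFin \o f)) ->
    bump_fun K ->
    dtdx.-integrable future (EFin \o (fun z => f z * (c * K (dil a z)))).
  move=> fi bK; apply: (@integrable_mul_bump_dil _ _ f (fun z => c * K z) r r0).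
    exact: bump_scale.
  exact: fi.
have I0 (f : X -> R) (K : V -> R) c : L1loc f -> bump_fun K ->
    dx.-integrable setT (EFin \o (fun x => f x * (c * K (dil a (0, x))))).
  move=> fi bK.
  apply: (@L1loc_mul_bump_dil _ _ f (fun z => c * K z) r r0) => //.
  exact: bump_scale.
have drop (f : X -> R) (K : V -> R) c : L1loc f -> bump_fun K ->
    \int[dx]_x (- u0 x * (c * K (dil a (0, x))) + f x * cutoff r (0, x)) =
    \int[dx]_x (f x * cutoff r (0, x)).
  move=> fi bK; have i1 := I0 _ _ c iu0 bK; have i2 := I0 _ _ 1 fi bp.
  rewrite /Rintegral; congr fine; rewrite cutoffE; apply: ae_eq_integral => //.
  - apply: (measurable_int dx); rewrite (_ : (fun x => _) =
      (EFin \o (fun x => (f x * (1 * profile (dil a (0, x))))%R)) \-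
      (EFin \o (fun x => (u0 x * (c * K (dil a (0, x))))%R)))%E; last first.
      by apply/funext => x /=; rewrite -EFinB; congr EFin; ring.
    exact: integrableB.
  - exact: (measurable_int dx i2).
  - by apply: filterS u00 => x u0x _; rewrite u0x oppr0 mul0r add0r.
have add_int (f g1 g2 : V -> R) :
    dtdx.-integrable future (EFin \o (fun z => f z * g1 z)) ->
    dtdx.-integrable future (EFin \o (fun z => f z * g2 z)) ->
    \int[dtdx]_(z in future) (f z * g1 z) +
    \int[dtdx]_(z in future) (f z * g2 z) =
    \int[dtdx]_(z in future) (f z * (g1 z + g2 z)).
  move=> i1 i2; rewrite -RintegralD//.
  by apply: eq_Rintegral => z _; rewrite mulrDr.
pose K1 : V -> R :=
  fun z => dt (dt profile) z + laplacian (laplacian profile) z.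
pose K2 : V -> R := laplacian (dt profile).
pose K3 : V -> R := laplacian profile.
pose K4 : V -> R := fun z => dt profile z + laplacian profile z.
have b1 : bump_fun K1.
  by apply: bump_add; [do 2 apply: bump_dt|do 2 apply: bump_laplacian].
have b2 : bump_fun K2 by apply/bump_laplacian/bump_dt.
have b3 : bump_fun K3 by exact: bump_laplacian.
have b4 : bump_fun K4 by apply: bump_add => //; exact: bump_dt.
have E1 : \int[dtdx]_(z in future) (f1 z * cutoff r z) +
    \int[dx]_x (u1 x * cutoff r (0, x)) =
    \int[dtdx]_(z in future) (u z * (a ^+ 4 * K1 (dil a z))) +
    \int[dtdx]_(z in future) (theta z * (a ^+ 2 * K3 (dil a z))).
  rewrite -(drop u1 (dt profile) (a ^+ 2) iu1 (bump_dt _ bp)).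
  (* The derivatives are abstracted so that rewriting them never unfolds the
     iterated derivatives of the profile. *)
  have eq1' d1 d2 l1 l2 : dt (cutoff r) = d1 -> dt (dt (cutoff r)) = d2 ->
      laplacian (cutoff r) = l1 -> laplacian (laplacian (cutoff r)) = l2 ->
      \int[dtdx]_(z in future) (f1 z * cutoff r z) +
      \int[dx]_x (- u0 x * d1 (0, x) + u1 x * cutoff r (0, x)) =
      \int[dtdx]_(z in future) (u z * (d2 z + l2 z)) +
      \int[dtdx]_(z in future) (theta z * l1 z).
    by move=> <- <- <- <-; exact: eq1.
  rewrite (eq1' _ _ _ _ dtE dtdtE lapE laplapE); congr (_ + _).
  by apply: eq_Rintegral => z _; rewrite -mulrDr.
have E2 : \int[dtdx]_(z in future) (f2 z * cutoff r z) +
    \int[dx]_x (theta0 x * cutoff r (0, x)) =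
    \int[dtdx]_(z in future) (theta z * (- a ^+ 2 * K4 (dil a z))) +
    \int[dtdx]_(z in future) (u z * (a ^+ 4 * K2 (dil a z))).
  rewrite -(drop theta0 (laplacian profile) (a ^+ 2) ith0
    (bump_laplacian _ bp)).
  have eq2' d1 l1 l2 : dt (cutoff r) = d1 -> laplacian (cutoff r) = l1 ->
      laplacian (dt (cutoff r)) = l2 ->
      \int[dtdx]_(z in future) (f2 z * cutoff r z) +
      \int[dx]_x (- u0 x * l1 (0, x) + theta0 x * cutoff r (0, x)) =
      \int[dtdx]_(z in future) (theta z * (- d1 z - l1 z)) +
      \int[dtdx]_(z in future) (u z * l2 z).
    by move=> <- <- <-; exact: eq2.
  rewrite (eq2' _ _ _ dtE lapE lapdtE); congr (_ + _).
  by apply: eq_Rintegral => z _; rewrite -opprD -mulrDr mulNr.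
have -> : \int[dtdx]_(z in future) ((f1 z + f2 z) * cutoff r z) =
    \int[dtdx]_(z in future) (f1 z * cutoff r z) +
    \int[dtdx]_(z in future) (f2 z * cutoff r z).
  rewrite cutoffE -RintegralD//;
    [|exact: II f1 profile 1 if1 bp|exact: II f2 profile 1 if2 bp].
  by apply: eq_Rintegral => z _; rewrite mulrDl.
have -> : \int[dx]_x ((u1 x + theta0 x) * cutoff r (0, x)) =
    \int[dx]_x (u1 x * cutoff r (0, x)) +
    \int[dx]_x (theta0 x * cutoff r (0, x)).
  rewrite cutoffE -RintegralD//;
    [|exact: I0 u1 profile 1 iu1 bp|exact: I0 theta0 profile 1 ith0 bp].
  by apply: eq_Rintegral => z _; rewrite mulrDl.
have -> : \int[dtdx]_(z in future) (u z * (a ^+ 4 * plate_adjoint (dil a z))) =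
    \int[dtdx]_(z in future) (u z * (a ^+ 4 * K1 (dil a z))) +
    \int[dtdx]_(z in future) (u z * (a ^+ 4 * K2 (dil a z))).
  rewrite (add_int _ _ _ (II u K1 (a ^+ 4) iu b1) (II u K2 (a ^+ 4) iu b2)).
  by apply: eq_Rintegral => z _; rewrite -mulrDr.
have -> : \int[dtdx]_(z in future) (theta z * (a ^+ 2 * dt profile (dil a z))) =
    - (\int[dtdx]_(z in future) (theta z * (a ^+ 2 * K3 (dil a z))) +
       \int[dtdx]_(z in future) (theta z * (- a ^+ 2 * K4 (dil a z)))).
  have i3 := II theta K3 (a ^+ 2) ith b3.
  have i4 := II theta K4 (- a ^+ 2) ith b4.
  rewrite (add_int _ _ _ i3 i4).
  rewrite -mulN1r -RintegralZl//; last first.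
    have := integrableD mfut i3 i4.
    by apply: eq_integrable => // z _ /=; rewrite -EFinD -mulrDr.
  by apply: eq_Rintegral => z _; rewrite /K3 /K4; ring.
rewrite opprK.
have regroup (A B C D U T T' U' : R) : A + B = U + T -> C + D = T' + U' ->
    A + C + (B + D) = U + U' + (T + T').
  by move=> AB CD; rewrite addrACA AB CD (addrC T') addrACA.
exact: regroup E1 E2.
Qed.

End summed_equation.

(** * Nonexistence of global solutions *)

Theorem theorem2p3 (R : realType) (n sigma : nat) (p c1 c2 c3 c4 : 'I_2 -> R)
    (u0 u1 theta0 : 'rV[R]_n -> R)
    (n_ge1 : (1 <= n)%N)
    (sigma12 : sigma = 1%N \/ sigma = 2%N)
    (p_gt1 : forall j, 1 < p j)
    (c_ge0 : forall j, [/\ 0 <= c1 j, 0 <= c2 j, 0 <= c3 j & 0 <= c4 j])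
    (c1_gt0 : 0 < c1 0 + c1 1)
    (c4_gt0 : 0 < c4 0 + c4 1)
    (p_le1 : forall j, 0 < c1 j ->
      ((p j)%:E <= 1 + 4%:E * inv_pospart (n%:R - 2))%E)
    (p_le4 : forall j, 0 < c4 j -> p j <= 1 + 2 / n%:R)
    (u0_eq0 : {ae lebesgue_rV R n, forall x, u0 x = 0})
    (data_L1 : (lebesgue_rV R n).-integrable setT
      (EFin \o (fun x => u1 x + theta0 x)))
    (data_gt0 : 0 < \int[lebesgue_rV R n]_x (u1 x + theta0 x)) :
  ~ exists u theta : R * 'rV[R]_n -> R,
      global_weak_solution sigma p c1 c2 c3 c4 u0 u1 theta0 u theta.
Proof.
move=> [u [theta [v [w [[u0L u1L th0L] hL eq1 eq2]]]]].
pose f j := source (p j) (c1 j) (c2 j) (c3 j) (c4 j) u v w theta.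
pose F z := f 0 z + f 1 z.
have mfut := @measurable_future R n.
have ord2 (j : 'I_2) : j = 0 \/ j = 1.
  by case: j => [[|[|//]] ?]; [left|right]; exact/val_inj.
have some_pos (c : 'I_2 -> R) : 0 < c 0 + c 1 -> exists j, 0 < c j.
  have [h0|h0] := ltrP 0 (c 0); first by exists 0.
  by move=> h; exists 1; apply: lt_le_trans h _; rewrite gerDr.
have [j cj] := some_pos _ c1_gt0; have [k ck] := some_pos _ c4_gt0.
have f_ge i z : [/\ 0 <= f i z, c1 i * `|u z| `^ p i <= f i z &
    c4 i * `|theta z| `^ p i <= f i z].
  by have [h1 h2 h3 h4] := c_ge0 i; exact: source_ge.
have f_int i : measurable_fun (@future R n) (f i) /\ forall r, 0 < r ->
    (lebesgue_measure \x lebesgue_rV R n)%E.-integrable (cylinder 0 r)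
      (EFin \o f i).
  have [h1 h2 h3 h4] := c_ge0 i; have [l1 l2 l3 l4] := hL i.
  by apply: integrable_source => // h; [have [] := l2 h|have [] := l3 h].
have fF i z : f i z <= F z.
  rewrite /F; have [a0 _ _] := f_ge 0 z; have [a1 _ _] := f_ge 1 z.
  by case: (ord2 i) => ->; rewrite ?lerDl ?lerDr.
have F0 z : 0 <= F z by have [a0 _ _] := f_ge 0 z; exact: le_trans (fF 0 z).
have uF z : c1 j * `|u z| `^ p j <= F z.
  by have [_ a1 _] := f_ge j z; exact: le_trans (fF j z).
have thF z : c4 k * `|theta z| `^ p k <= F z.
  by have [_ _ a1] := f_ge k z; exact: le_trans (fF k z).
have mF : measurable_fun (@future R n) F.
  by apply: measurable_funD; [have [] := f_int 0|have [] := f_int 1].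
have [[_ if0] [_ if1]] := (f_int 0, f_int 1).
have iF r : 0 < r ->
    (lebesgue_measure \x lebesgue_rV R n)%E.-integrable (cylinder 0 r)
      (EFin \o F).
  move=> r0.
  exact: (integrableD (measurable_cylinder 0 r) (if0 r r0) (if1 r r0)).
have up : Lploc (p j) u by have [h _ _ _] := hL j; exact: h.
have thp : Lploc (p k) theta by have [_ _ _ h] := hL k; exact: h.
have n0 : 0 < n%:R :> R by rewrite ltr0n.
(* Both exponent conditions are (n + 2 - m) (p - 1) <= m, with m = 4 for u and
   m = 2 for theta. *)
have crit_u : ((n + 2)%:R - 4%:R) * (p j - 1) <= 4%:R.
  have pj := p_gt1 j; rewrite natrD; have := p_le1 j cj; rewrite /inv_pospart.
  case: ifPn => [n2 _|]; first by nra.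
  rewrite -ltNge => n2; rewrite -EFinM -EFinD lee_fin => pn.
  have : (n%:R - 2) * (p j - 1) <= (n%:R - 2) * (4 * (n%:R - 2)^-1).
    by rewrite ler_pM2l//; lra.
  by rewrite mulrCA mulfV ?gt_eqF//; lra.
have crit_th : ((n + 2)%:R - 2%:R) * (p k - 1) <= 2%:R.
  rewrite natrD addrK; have := p_le4 k ck => pn.
  have : n%:R * (p k - 1) <= n%:R * (2 / n%:R) by rewrite ler_pM2l//; lra.
  by rewrite mulrCA mulfV ?gt_eqF// mulr1.
have bA := @bump_plate_adjoint R n; have bB := bump_dt _ (@bump_profile R n).
have identity r : 0 < r -> _ := fun r0 => summed_equation (f 0) (f 1) u theta
  u0 u1 theta0 r r0 if0 if1
  (fun s s0 => Lploc_integrable _ _ _ (ltW (p_gt1 j)) s0 up)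
  (fun s s0 => Lploc_integrable _ _ _ (ltW (p_gt1 k)) s0 thp)
  u0L u1L th0L u0_eq0 eq1 eq2.
(* Each of the two terms absorbs a quarter of the integral of F, so that one
   half of it is left on the left-hand side. *)
have e4 : 0 < 4^-1 :> R by rewrite invr_gt0.
have [M HM] := absorption u F _ (p j) (c1 j) 4 (p_gt1 j) cj bA up uF iF
  crit_u _ e4.
have [N HN] := absorption theta F _ (p k) (c4 k) 2 (p_gt1 k) ck bB thp thF iF
  crit_th _ e4.
pose B := \int[lebesgue_rV R n]_x `|u1 x + theta0 x|.
have data_le r : 0 < r ->
    `|\int[lebesgue_rV R n]_x ((u1 x + theta0 x) * cutoff r (0, x))| <= B.
  move=> r0.
  have di : (lebesgue_rV R n).-integrable setT
      (EFin \o (fun x => (u1 x + theta0 x) * cutoff r (0, x))).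
    apply: (@integrable_mul_supported _ _ _ _ setT setT
      (fun x => u1 x + theta0 x) (fun x => cutoff r (0, x)) 1) => //.
    - exact: (measurableT_comp (bump_dil_measurable r^-1 _ bump_profile)
        (measurable_slice 0)).
    - by move=> x; rewrite ger0_norm ?cutoff_ge0 ?cutoff_le1.
  apply: le_trans (le_normr_Rintegral measurableT di) _.
  apply: le_Rintegral => //; first exact: integrable_norm.
    exact: integrable_norm data_L1.
  move=> x _; rewrite normrM ler_piMr// ger0_norm ?cutoff_ge0//.
  exact: cutoff_le1.
pose I i := \int[(lebesgue_measure \x lebesgue_rV R n)%E]_(z in @future R n)
  (F z * cutoff i.+1%:R z).
have I_le i : I i <= 2 * (M + N + B).
  have i0 : 0 < i.+1%:R :> R by rewrite ltr0n.
  have i1 : 1 <= i.+1%:R :> R by rewrite ler1n.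
  have absorb (x d y1 y2 : R) : x + d = y1 - y2 -> `|d| <= B ->
      `|y1| <= 4^-1 * x + M -> `|y2| <= 4^-1 * x + N -> x <= 2 * (M + N + B).
    clear; rewrite !ler_norml => ? /andP[? ?] /andP[? ?] /andP[? ?]; lra.
  exact: absorb (identity _ i0) (data_le _ i0) (HM _ i1) (HN _ i1).
have Fi : (lebesgue_measure \x lebesgue_rV R n)%E.-integrable (@future R n)
    (EFin \o F).
  apply: (@integrable_weight_limit _ (measurableTypeR R * 'rV[R]_n)%type R
    (lebesgue_measure \x lebesgue_rV R n)%E (@future R n) F
    (fun i => cutoff i.+1%:R) (flat 1 1) (2 * (M + N + B))) => //.
  - by move=> i z; exact: cutoff_ge0.
  - move=> i; apply: (@weighted_integrable _ _ F iF); by rewrite ltr0n.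
  - exact: flat11_gt0.
  - by move=> z; exact: cutoff_cvg.
have U0 := vanishing u F _ (p j) (c1 j) 4 (p_gt1 j) cj isT bA up uF
  crit_u Fi.
have T0 := vanishing theta F _ (p k) (c4 k) 2 (p_gt1 k) ck isT bB thp thF
  crit_th Fi.
pose U i := \int[(lebesgue_measure \x lebesgue_rV R n)%E]_(z in @future R n)
  (u z * (i.+1%:R^-1 ^+ 4 * plate_adjoint (dil i.+1%:R^-1 z))).
pose T i := \int[(lebesgue_measure \x lebesgue_rV R n)%E]_(z in @future R n)
  (theta z * (i.+1%:R^-1 ^+ 2 * dt profile (dil i.+1%:R^-1 z))).
have UT0 : U i - T i @[i --> \oo] --> (0 : R).
  by rewrite -[X in _ --> X](subr0 0); apply: cvgB; [exact: U0|exact: T0].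
have D1 := data_cvg _ data_L1.
have : flat 1 1 * \int[lebesgue_rV R n]_x (u1 x + theta0 x) <= 0.
  apply: (ler_cvg_to D1 UT0); apply: nearW => i.
  have i0 : 0 < i.+1%:R :> R by rewrite ltr0n.
  have I0 : 0 <= I i.
    by apply: Rintegral_ge0 => z _; rewrite mulr_ge0 ?cutoff_ge0.
  by rewrite -[leRHS](identity _ i0) lerDr.
by rewrite leNgt mulr_gt0 ?flat11_gt0.
Qed.
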